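(* Let $g:\mathbb{R}\to\mathbb{C}$ be continuous with $|g(x)|\le A\exp(B|x|^{\rho})$ for all $x\in\mathbb{R}$, for some constants $A,B$ and some $\rho<2$. Let $H$ be the classical solution of the heat equation with boundary condition $g$. Let $\eta,\omega,\omega'\in{}^{*}\mathbb{N}\setminus\mathbb{N}$ with $\eta-\omega$ positive infinite, $\omega<\omega'^{1/2}$ and $\omega'<({}^{*}\log\eta)^{1/2}$. Let $g_\eta$ be the measurable extension of $g$ to $\overline{\mathcal R_\eta}$, let $g_{\eta,\omega}=g_\eta\,\chi_{[-\omega,\omega)}$, and let $\hat f$ be the nonstandard Fourier transform in space of the unique measurable $f:\overline{\mathcal T_\eta}\times\overline{\mathcal R_\eta}\to{}^{*}\mathbb{C}$ satisfying $$\frac{\partial f}{\partial t}-\frac{\partial^2 f}{\partial x^2}=0\ \text{ on }\ \Big(\overline{\mathcal T_\eta}\setminus\big[\tfrac{\eta^2-1}{\eta},\eta\big)\Big)\times\overline{\mathcal R_\eta},\qquad f(0,x)=g_{\eta,\omega}(x)\ \ (x\in\overline{\mathcal R_\eta}).$$ Then, with $(F_{\omega'}\hat f)^{\vee}$ the nonstandard inverse Fourier transform in space of $F_{\omega'}\hat f$, for all finite $t\in\overline{\mathcal T_\eta}$ with ${}^{\circ}t>0$ and all finite $x\in\overline{\mathcal R_\eta}$, $${}^{\circ}\big((F_{\omega'}\hat f)^{\vee}(t,x)\big)=H({}^{\circ}t,{}^{\circ}x).$$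
   Context: Work in a (countably saturated) nonstandard universe; ${}^{\circ}$ denotes standard part. For infinite $\eta\in{}^{*}\mathbb{N}\setminus\mathbb{N}$ let $\overline{\mathcal R_\eta}=\{x\in{}^{*}\mathbb{R}:-\eta\le x<\eta\}$ and $\overline{\mathcal T_\eta}=\{t\in{}^{*}\mathbb{R}:0\le t<\eta\}$, divided into cells $[\frac{j}{\eta},\frac{j+1}{\eta})$ ($j\in{}^{*}\mathbb{Z}$; $-\eta^2\le j\le\eta^2-1$, resp. $0\le j\le\eta^2-1$). A function on $\overline{\mathcal R_\eta}$ (or on $\overline{\mathcal T_\eta}\times\overline{\mathcal R_\eta}$, or $\overline{\mathcal R_\eta}^2$) is measurable if it is internal and constant on each cell (product of cells). Each cell of $\overline{\mathcal R_\eta}$ has $\lambda_\eta$-measure $1/\eta$, so for measurable $u$, $\int_{\overline{\mathcal R_\eta}}u\,d\lambda_\eta=\frac1\eta{}^{*}\sum_{j=-\eta^2}^{\eta^2-1}u(\frac j\eta)$. $[\cdot]$ is the (transferred) integer part. The measurable extension of $g:\mathbb{R}\to\mathbb{C}$ is $g_\eta(x)={}^{*}g([\eta x]/\eta)$. $\chi_{[-\omega,\omega)}$ is the indicator function of $[-\omega,\omega)$. Discrete derivatives of measurable $f$: $\frac{\partial f}{\partial t}(\frac j\eta,x)=\eta(f(\frac{j+1}\eta,x)-f(\frac j\eta,x))$ for $0\le j\le\eta^2-2$, and $\frac{\partial f}{\partial t}(\frac{\eta^2-1}{\eta},x)=0$; $\frac{\partial f}{\partial x}(t,\frac j\eta)=\eta(f(t,\frac{j+1}\eta)-f(t,\frac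 j\eta))$ for $-\eta^2\le j\le\eta^2-2$, and $\frac{\partial f}{\partial x}(t,\frac{\eta^2-1}\eta)=0$ (extended to be constant on cells); $\frac{\partial^2 f}{\partial x^2}$ is the iterate. Given measurable boundary data there is a unique measurable solution of the nonstandard heat equation. $\exp_\eta(\pm\pi ixy)={}^{*}\exp(\pm\pi i\frac{[\eta x]}{\eta}\frac{[\eta y]}{\eta})$. For measurable $f$ on $\overline{\mathcal T_\eta}\times\overline{\mathcal R_\eta}$, the Fourier transform in space is $\hat f(t,y)=\int_{\overline{\mathcal R_\eta}}f(t,x)\exp_\eta(-\pi ixy)\,d\lambda_\eta(x)$ and the inverse Fourier transform in space is $\check{f}(t,y)=f^{\vee}(t,y)=\int_{\overline{\mathcal R_\eta}}f(t,x)\exp_\eta(\pi ixy)\,d\lambda_\eta(x)$. $F_{\omega'}:\overline{\mathcal T_\eta}\times\overline{\mathcal R_\eta}\to{}^{*}\mathbb{R}$ is the measurable function with $F_{\omega'}(t,\frac j\eta)=\frac12$ if $-\omega'\eta\le j\le\omega'\eta$ and $0$ otherwise. Classical solution: $H(0,x)=g(x)$ and $H(t,x)=\frac{1}{\sqrt{4\pi t}}\int_{\mathbb{R}}\exp\big(\frac{-(x-y)^2}{4t}\big)g(y)\,dy$ for $t>0$. *)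

(* Defs.v *)
From HB Require Import structures.
From mathcomp Require Import all_boot all_order all_algebra.
From mathcomp Require Import complex.
From mathcomp Require Import all_classical all_reals all_analysis.
Set Implicit Arguments.
Unset Strict Implicit.
Unset Printing Implicit Defensive.
Import Order.TTheory GRing.Theory Num.Theory numFieldNormedType.Exports.
Local Open Scope ring_scope.

(** A nonstandard universe is presented functorially: every type [A] has an
    extension [star A] (the set *A) and every map [h : A -> B] an extension
    [smap h : star A -> star B].  The axioms say that the extension preserves
    composition, pairs, the two-element set and the equality relation.  They are
    equivalent to the transfer principle for all first-order formulas over all
    standard types (including function types, whose extensions consist of the
    internal functions): see the [sholds_*] lemmas below. *)
Record nsuniverse := NSUniverse {
  star : Type -> Type;
  smap : forall A B : Type, (A -> B) -> star A -> star B;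
  sconst : forall A : Type, A -> star A;
  spair : forall A B : Type, star A -> star B -> star (A * B);
  smap_id : forall (A : Type) (x : star A), smap (fun a => a) x = x;
  smap_comp : forall (A B C : Type) (h : B -> C) (k : A -> B) (x : star A),
    smap (fun a => h (k a)) x = smap h (smap k x);
  smap_const : forall (A B : Type) (b : B) (x : star A),
    smap (fun=> b) x = sconst b;
  smap_sconst : forall (A B : Type) (h : A -> B) (a : A),
    smap h (sconst a) = sconst (h a);
  smap_fst : forall (A B : Type) (x : star A) (y : star B),
    smap fst (spair x y) = x;
  smap_snd : forall (A B : Type) (x : star A) (y : star B),
    smap snd (spair x y) = y;
  spair_eta : forall (A B : Type) (z : star (A * B)),
    spair (smap fst z) (smap snd z) = z;
  star_bool : forall b : star bool, b = sconst true \/ b = sconst false;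
  star_bool_neq : sconst true <> sconst false;
  star_eq : forall (A : Type) (x y : star A),
    smap (fun p : A * A => `[< p.1 = p.2 >]) (spair x y) = sconst true -> x = y
}.

Arguments smap {n A B} h x.
Arguments sconst {n A} a.
Arguments spair {n A B} x y.

Section Transfer.
Variable U : nsuniverse.
Local Notation star := (star U).

Definition sholds (A : Type) (P : A -> Prop) (x : star A) : Prop :=
  smap (fun a => `[< P a >]) x = sconst true.

Definition smap2 (A B C : Type) (h : A -> B -> C) (x : star A) (y : star B) :
  star C := smap (fun p => h p.1 p.2) (spair x y).

Definition sholds2 (A B : Type) (P : A -> B -> Prop) (x : star A) (y : star B) :
  Prop := sholds (fun p => P p.1 p.2) (spair x y).

Definition sapp (A B : Type) (F : star (A -> B)) (x : star A) : star B :=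
  smap2 (fun h a => h a) F x.

Definition smem (A : Type) (x : star A) (S : star (set A)) : Prop :=
  sholds2 (fun a X => X a) x S.

Definition countably_saturated : Prop :=
  forall (A : Type) (S : nat -> star (set A)),
    (forall n : nat, exists x, forall k : nat, (k <= n)%N -> smem x (S k)) ->
    exists x, forall n : nat, smem x (S n).

Lemma smap_pairE (A B C : Type) (h : A -> B) (k : A -> C) (x : star A) :
  smap (fun a => (h a, k a)) x = spair (smap h x) (smap k x).
Proof. by rewrite -[LHS]spair_eta -!smap_comp. Qed.

Lemma sconst_pair (A B : Type) (a : A) (b : B) :
  spair (sconst a) (sconst b) = sconst (a, b) :> star (A * B).
Proof. by rewrite -[RHS]spair_eta !smap_sconst. Qed.

Lemma sholds_sconst (A : Type) (P : A -> Prop) (a : A) :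
  sholds P (sconst a) <-> P a.
Proof.
rewrite /sholds smap_sconst; split=> [|Pa]; last by rewrite asboolT.
by case: (asboolP (P a)) => // _ /esym /star_bool_neq.
Qed.

Lemma sholds_smap (A B : Type) (h : A -> B) (P : B -> Prop) (x : star A) :
  sholds P (smap h x) <-> sholds (fun a => P (h a)) x.
Proof. by rewrite /sholds -smap_comp. Qed.

Lemma sholds_all (A : Type) (P : A -> Prop) (x : star A) :
  (forall a, P a) -> sholds P x.
Proof.
move=> allP; rewrite /sholds (_ : (fun _ => _) = fun=> true) ?smap_const //.
by apply/funext => a; rewrite asboolT.
Qed.

Lemma sholds_eq (A B : Type) (h k : A -> B) (x : star A) :
  sholds (fun a => h a = k a) x <-> smap h x = smap k x.
Proof.
split=> [hk|hk].
  by apply: star_eq; rewrite -smap_pairE -smap_comp.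
suff: sholds (fun p : B * B => p.1 = p.2) (spair (smap h x) (smap k x)).
  by rewrite -smap_pairE sholds_smap.
rewrite hk -smap_pairE; apply/sholds_smap; exact: sholds_all.
Qed.

Lemma sholds_not (A : Type) (P : A -> Prop) (x : star A) :
  sholds (fun a => ~ P a) x <-> ~ sholds P x.
Proof.
rewrite /sholds (_ : (fun a => `[< ~ P a >]) = fun a => ~~ `[< P a >]); last first.
  by apply/funext => a; rewrite asbool_neg.
rewrite (smap_comp negb); have neq := @star_bool_neq U.
case: (star_bool (smap (fun a => `[< P a >]) x)) => ->; rewrite smap_sconst /=.
- by split=> [/esym|]//.
- by split=> // _ /esym.
Qed.

Lemma sholds_and (A : Type) (P Q : A -> Prop) (x : star A) :
  sholds (fun a => P a /\ Q a) x <-> sholds P x /\ sholds Q x.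
Proof.
rewrite /sholds (_ : (fun a => `[< P a /\ Q a >]) =
  fun a => (fun p : bool * bool => p.1 && p.2) (`[< P a >], `[< Q a >])); last first.
  by apply/funext => a; rewrite asbool_and.
rewrite (smap_comp (fun p : bool * bool => p.1 && p.2)) smap_pairE.
have neq := @star_bool_neq U.
case: (star_bool (smap (fun a => `[< P a >]) x)) => ->;
case: (star_bool (smap (fun a => `[< Q a >]) x)) => ->;
by rewrite sconst_pair smap_sconst /=; split=> // -[] // /esym ? /esym ?.
Qed.

Lemma sholds_ex (A B : Type) (P : A -> B -> Prop) (x : star A) :
  sholds (fun a => exists b, P a b) x <-> exists y, sholds2 P x y.
Proof.
split=> [exP|[y Pxy]]; last first.
  rewrite -[x](smap_fst x y); apply/sholds_smap.
  apply: contrapT => /sholds_not nP.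
  have [] : sholds (fun p => P p.1 p.2 /\ ~ exists b, P p.1 b) (spair x y) -> False.
    move=> h; apply: (@star_bool_neq U); rewrite -h -(smap_const false (spair x y)).
    congr smap; apply/funext => p; rewrite asboolF// => -[Pp []].
    by exists p.2.
  by apply/sholds_and.
have [[b0 _]|nB] := pselect (exists b : B, True); last first.
  exfalso; apply: (@star_bool_neq U); move: exP; rewrite /sholds => <-.
  rewrite -(smap_const false x).
  by congr smap; apply/funext => a; rewrite asboolF// => -[b _]; apply: nB; exists b.
have [h hP] : {h : A -> B & forall a, (exists b, P a b) -> P a (h a)}.
  apply: (@choice _ _ (fun a b => (exists b, P a b) -> P a b)) => a.
  have [[b Pb]|nb] := pselect (exists b, P a b); first by exists b.
  by exists b0.
exists (smap h x); rewrite /sholds2 -{1}[x]smap_id -smap_pairE.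
apply/sholds_smap; move: exP; rewrite /sholds => <-; congr smap; apply/funext => a.
by apply/asbool_equiv_eq; split=> [Pa|/hP//]; exists (h a).
Qed.

Lemma sholds_forall (A B : Type) (P : A -> B -> Prop) (x : star A) :
  sholds (fun a => forall b, P a b) x <-> forall y, sholds2 P x y.
Proof.
have -> : (fun a => forall b, P a b) = fun a => ~ exists b, ~ P a b.
  apply/funext => a; apply/propext; split=> [Pa [b]|nP b]; first exact.
  by apply: contrapT => nPb; apply: nP; exists b.
rewrite sholds_not sholds_ex; split=> [nP y|allP [y]].
  by apply: contrapT => /sholds_not nPy; apply: nP; exists y.
by move=> /sholds_not; apply; exact: allP.
Qed.

End Transfer.

Declare Scope hyper_scope.
Delimit Scope hyper_scope with H.

Definition hzero {U : nsuniverse} {V : nmodType} : star U V := sconst 0.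
Definition hone {U : nsuniverse} {V : pzSemiRingType} : star U V := sconst 1.
Definition hadd {U : nsuniverse} {V : nmodType} : star U V -> star U V -> star U V :=
  smap2 (fun a b => a + b).
Definition hopp {U : nsuniverse} {V : zmodType} : star U V -> star U V :=
  smap (fun a => - a).
Definition hsub {U : nsuniverse} {V : zmodType} : star U V -> star U V -> star U V :=
  smap2 (fun a b => a - b).
Definition hmul {U : nsuniverse} {V : pzSemiRingType} :
    star U V -> star U V -> star U V :=
  smap2 (fun a b => a * b).
Definition hdiv {U : nsuniverse} {V : unitRingType} :
    star U V -> star U V -> star U V :=
  smap2 (fun a b => a / b).
Definition hle {U : nsuniverse} {d : Order.disp_t} {T : porderType d} :
    star U T -> star U T -> Prop :=
  sholds2 (fun a b => (a <= b)%O).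
Definition hlt {U : nsuniverse} {d : Order.disp_t} {T : porderType d} :
    star U T -> star U T -> Prop :=
  sholds2 (fun a b => (a < b)%O).

Notation "0" := hzero : hyper_scope.
Notation "1" := hone : hyper_scope.
Notation "x + y" := (hadd x y) : hyper_scope.
Notation "- x" := (hopp x) : hyper_scope.
Notation "x - y" := (hsub x y) : hyper_scope.
Notation "x * y" := (hmul x y) : hyper_scope.
Notation "x / y" := (hdiv x y) : hyper_scope.
Notation "x <= y" := (hle x y) : hyper_scope.
Notation "x < y" := (hlt x y) : hyper_scope.

Section Casts.
Variable U : nsuniverse.
Definition hnatZ : star U nat -> star U int := smap Posz.
Definition hnatR (R : realType) : star U nat -> star U R := smap (fun n => n%:R).
Definition hintR (R : realType) : star U int -> star U R := smap (fun j => j%:~R).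
Definition hrealC (R : realType) : star U R -> star U R[i] :=
  smap (fun r => r%:C%C).
Definition hfloor (R : realType) : star U R -> star U int :=
  smap (fun r => Num.floor r).
End Casts.
Arguments hnatR {U} R.
Arguments hintR {U} R.

Definition infinite_hnat (U : nsuniverse) (n : star U nat) : Prop :=
  forall k : nat, n <> sconst k.

Definition pos_infinite (U : nsuniverse) (R : realType) (x : star U R) : Prop :=
  forall r : R, (sconst r < x)%H.

Section StandardPart.
Variables (U : nsuniverse) (R : realType).

Definition finiteR (x : star U R) : Prop :=
  exists r : R, (smap (fun a => `|a|) x <= sconst r)%H.

Definition finiteC (z : star U R[i]) : Prop :=
  exists r : R, (smap (fun a => `|a|) z <= sconst (r%:C%C : R[i]))%H.

Definition infinitesimal (x : star U R) : Prop :=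
  forall e : R, 0 < e -> (smap (fun a => `|a|) x < sconst e)%H.

(* meaningful for finite arguments only *)
Definition st (x : star U R) : R :=
  xget 0 [set r : R | infinitesimal (x - sconst r)%H].

Definition stC (z : star U R[i]) : R[i] :=
  (st (smap (@complex.Re R) z) +i* st (smap (@complex.Im R) z))%C.

End StandardPart.

Definition cexp (R : realType) (z : R[i]) : R[i] :=
  ((expR (complex.Re z))%:C * (cos (complex.Im z) +i* sin (complex.Im z)))%C.

Definition cintegral (R : realType) (h : R -> R[i]) : R[i] :=
  ((\int[@lebesgue_measure R]_x complex.Re (h x)) +i*
   (\int[@lebesgue_measure R]_x complex.Im (h x)))%C.

Definition heat_solution (R : realType) (g : R -> R[i]) (t x : R) : R[i] :=
  if 0 < t then
    (((Num.sqrt (4 * pi * t))^-1)%:C *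
     cintegral (fun y => (expR (- (x - y) ^+ 2 / (4 * t)))%:C * g y))%C
  else g x.

(* the sum of a(j) over -n <= j <= n - 1 *)
Definition symsum (R : realType) (n : nat) (a : int -> R[i]) : R[i] :=
  \sum_(k < n.*2) a (k%:Z - n%:Z).

Section Discrete.
Variables (U : nsuniverse) (R : realType) (eta : star U nat).
Local Open Scope hyper_scope.

Local Notation hR := (star U R).
Local Notation hC := (star U R[i]).
Local Notation etaR := (hnatR R eta).
Local Notation etaC := (hrealC (hnatR R eta)).
Local Notation eta2 := (hnatZ eta * hnatZ eta).

Definition in_space (x : hR) : Prop := - etaR <= x /\ x < etaR.

Definition in_time (t : hR) : Prop := 0 <= t /\ t < etaR.

Definition space_index (j : star U int) : Prop := - eta2 <= j /\ j <= eta2 - 1.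

Definition time_index (j : star U int) : Prop := 0 <= j /\ j <= eta2 - 1.

Definition gridpt (j : star U int) : hR := hintR R j / etaR.

Definition in_cell (j : star U int) (x : hR) : Prop :=
  gridpt j <= x /\ x < gridpt (j + 1).

Definition last_time_cell (t : hR) : Prop := in_cell (eta2 - 1) t.

Definition internal2 (f : hR -> hR -> hC) : Prop :=
  exists F : star U (R -> R -> R[i]),
    forall t x, in_time t -> in_space x -> f t x = sapp (sapp F t) x.

Definition measurable2 (f : hR -> hR -> hC) : Prop :=
  internal2 f /\
  forall i j, time_index i -> space_index j ->
  forall t t' x x', in_cell i t -> in_cell i t' -> in_cell j x -> in_cell j x' ->
    f t x = f t' x'.

(* [hfloor (etaR * t)] is the index of the cell containing [t] *)
Definition ddt (f : hR -> hR -> hC) (t x : hR) : hC :=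
  let j := hfloor (etaR * t) in
  if `[< j <= eta2 - sconst 2%:Z >] then
    etaC * (f (gridpt (j + 1)) x - f (gridpt j) x)
  else 0.

Definition ddx (f : hR -> hR -> hC) (t x : hR) : hC :=
  let j := hfloor (etaR * x) in
  if `[< j <= eta2 - sconst 2%:Z >] then
    etaC * (f t (gridpt (j + 1)) - f t (gridpt j))
  else 0.

(* Hyperfinite sum of a(j) over -N <= j <= N - 1: it is defined for [a] internal
   on the range of summation, as the extension of [symsum] at any internal function
   that agrees with [a] there (the choice is irrelevant by transfer); it takes the
   junk value 0 when there is none. *)
Definition hsum (N : star U nat) (a : star U int -> hC) : hC :=
  if pselect (exists F : star U (int -> R[i]),
      forall j, - hnatZ N <= j -> j <= hnatZ N - 1 -> sapp F j = a j) is left exF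
  then smap2 (@symsum R) N (projT1 (cid exF)) else 0.

Definition hintegral (u : hR -> hC) : hC :=
  1 / etaC * hsum (eta * eta) (fun j => u (gridpt j)).

(* exp_eta (s pi i x y), for s = 1 or -1 *)
Definition exp_eta (s : R) (x y : hR) : hC :=
  smap (@cexp R)
    (sconst (Complex 0 (s * pi))%R * hrealC (gridpt (hfloor (etaR * x)))
                             * hrealC (gridpt (hfloor (etaR * y)))).

Definition fourier (f : hR -> hR -> hC) (t y : hR) : hC :=
  hintegral (fun x => f t x * exp_eta (-1)%R x y).

Definition inv_fourier (f : hR -> hR -> hC) (t y : hR) : hC :=
  hintegral (fun x => f t x * exp_eta 1%R x y).

Definition measurable_ext (g : R -> R[i]) (x : hR) : hC :=
  smap g (gridpt (hfloor (etaR * x))).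

Definition indic_window (omega : star U nat) (x : hR) : hR :=
  if `[< - hnatR R omega <= x /\ x < hnatR R omega >] then 1 else 0.

Definition truncated_ext (g : R -> R[i]) (omega : star U nat) (x : hR) : hC :=
  measurable_ext g x * hrealC (indic_window omega x).

Definition cutoff (omega' : star U nat) (t x : hR) : hR :=
  let j := hfloor (etaR * x) in
  if `[< - (hnatZ omega' * hnatZ eta) <= j /\ j <= hnatZ omega' * hnatZ eta >]
  then sconst (2^-1)%R else 0.

Definition heat_equation (f : hR -> hR -> hC) : Prop :=
  forall t x, in_time t -> ~ last_time_cell t -> in_space x ->
    ddt f t x - ddx (ddx f) t x = 0.

End Discrete.

(* Main.v *)
Require Import Defs.
From HB Require Import structures.
From mathcomp Require Import all_boot all_order all_algebra.
From mathcomp Require Import complex.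
From mathcomp Require Import all_classical all_reals all_analysis.
From mathcomp Require Import ring lra zify.
Import Order.TTheory GRing.Theory Num.Theory numFieldNormedType.Exports.
Import ComplexField.Normc.
Local Open Scope ring_scope.

(** For a standard n, the equation is the explicit recurrence
    f_(i+1) = f_i + n (S - 1)^2 f_i with S the shift by one cell to the left.
    Up to a finite time the support of f stays inside the window, because
    eta - omega is infinite, so the Fourier transform of f_i is exactly m^i times
    that of f_0, with m(k) = 1 + n (e^(i pi k / n^2) - 1)^2.  The recurrence is
    wildly unstable, but on the frequencies kept by the cutoff m(k)^i is
    exp(- pi^2 (k/n)^2 (i/n)) up to O(omega'^4 / n), and n > exp(omega'^2) beats
    the growth exp(omega') of g on the window.  What remains is the convolution of
    g with a truncated Riemann sum of the Fourier integral of a Gaussian.  As a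
    function of u this sum nearly solves K' = - u K / (2 a), hence it is
    exp(- u^2 / (4 a)) K(0) up to a small error, and the limit of the convolution
    follows by dominated convergence applied to step functions.  All this is an
    epsilon-delta statement on finite sums (discrete_solution_lim), which transfers
    to the infinite eta, omega, omega'. *)

(** * Elementary estimates *)

(** With time and space steps both [1 / n], the time step divided by the square of the space step is
    [n], and [1 + n (cis a - 1) ^ 2] reaches [1 + 4 n] at [a = - pi]. Hence the values of the
    solution are never estimated, only its transform at the frequencies that the cutoff keeps. The
    value [1/2] of the cutoff is the constant of Fourier inversion for the kernel [exp(- pi i x y)].
    The window grows with [omega], so the comparison with a Gaussian must be uniform for
    [|u| <= x1 + P]: limits at fixed [u] would not do, and error bounds explicit in [P] and [n] are
    needed. The differential equation in [u] yields them by real calculus alone and reduces the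
    limit to [u = 0], where the sum is a Riemann sum of a Gaussian. Dominated convergence speaks of
    sequences while transfer needs thresholds; the passage is by contradiction and choice. *)

Lemma derive_bound {R : realType} (f df : R -> R) (a b C : R) :
  a <= b -> (forall x : R, is_derive x 1 f (df x)) ->
  (forall x, a <= x <= b -> `|df x| <= C) -> `|f b - f a| <= C * (b - a).
Proof.
move=> ab fdf dfC.
have [|x xab ->] := MVT_segment ab (fun x _ => fdf x).
  apply: continuous_subspaceT => x; apply: differentiable_continuous.
  by apply/derivable1_diffP; case: (fdf x).
have ba : 0 <= b - a by rewrite subr_ge0.
by rewrite normrM (ger0_norm ba) ler_wpM2r// dfC// -(@in_itv _ _ x `[a, b]).
Qed.

Lemma norm_sin_le {R : realType} (x : R) : `|sin x| <= `|x|.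
Proof.
wlog x0 : x / 0 <= x => [hw|].
  have [|/ltW x0] := leP 0 x; first exact: hw.
  by rewrite -normrN -sinN -(normrN x) hw// oppr_ge0.
have := @derive_bound R sin cos 0 x 1 x0 _ (fun y _ => cos_max y).
by rewrite sin0 !subr0 mul1r (ger0_norm x0); apply => y; exact: is_derive_sin.
Qed.

(** On the segment the derivative is at most [x], so the mean value inequality gives [x * x]. This
    loses a factor 2 against Taylor; only the orders matter later. *)
Lemma norm_cosB1_le {R : realType} (x : R) : `|cos x - 1| <= x ^+ 2.
Proof.
wlog x0 : x / 0 <= x => [hw|].
  have [|/ltW x0] := leP 0 x; first exact: hw.
  by rewrite -cosN -sqrrN hw// oppr_ge0.
rewrite -[1]cos0 expr2 -[X in _ <= _ * X]subr0.
apply: (@derive_bound R cos (fun y => - sin y)) => // y /andP[y0 yx].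
by rewrite normrN (le_trans (norm_sin_le _))// ger0_norm.
Qed.

Lemma norm_cosB1_le_abs {R : realType} (x : R) : `|cos x - 1| <= `|x|.
Proof.
wlog x0 : x / 0 <= x => [hw|].
  have [|/ltW x0] := leP 0 x; first exact: hw.
  by rewrite -cosN -[leRHS]normrN hw// oppr_ge0.
rewrite -[1]cos0 (ger0_norm x0) -[X in _ <= X]mul1r -[X in _ <= _ * X]subr0.
apply: (@derive_bound R cos (fun y => - sin y)) => // y _.
by rewrite normrN sin_max.
Qed.

Lemma norm_sinBid_le {R : realType} (x : R) : `|sin x - x| <= x ^+ 2.
Proof.
wlog x0 : x / 0 <= x => [hw|].
  have [|/ltW x0] := leP 0 x; first exact: hw.
  have -> : sin x - x = - (sin (- x) - - x) by rewrite sinN; ring.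
  by rewrite normrN -sqrrN hw// oppr_ge0.
have -> : sin x - x = (sin x - x) - (sin 0 - 0) by rewrite sin0 subr0 subr0.
rewrite expr2 -[X in _ <= _ * X]subr0.
apply: (@derive_bound R (fun y => sin y - y) (fun y => cos y - 1)) => //.
move=> y /andP[y0 yx].
by rewrite (le_trans (norm_cosB1_le_abs _))// ger0_norm.
Qed.

(** From above, [expR (- s) <= 1 / (1 + s) <= 1 - s + s ^ 2], the last step because
    [(1 + s) (1 - s + s ^ 2) = 1 + s ^ 3]. *)
Lemma norm_expRN_le {R : realType} (s : R) : 0 <= s ->
  `|expR (- s) - (1 - s)| <= s ^+ 2.
Proof.
move=> s0; have h := expR_ge1Dx (- s).
rewrite ger0_norm; last lra.
have s1 : 0 < 1 + s by lra.
have : expR (- s) <= (1 + s)^-1.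
  by rewrite expRN lef_pV2 ?posrE ?expR_gt0// expR_ge1Dx.
suff : (1 + s)^-1 <= 1 - s + s ^+ 2 by lra.
rewrite -[X in X <= _]mul1r ler_pdivrMr//.
have : 0 <= s ^+ 3 by rewrite exprn_ge0.
lra.
Qed.

Lemma normc_le_abs {R : realType} (z : R[i]) :
  normc z <= `|complex.Re z| + `|complex.Im z|.
Proof.
case: z => a b /=; rewrite -(@ler_pXn2r _ 2) ?nnegrE ?sqrtr_ge0 ?addr_ge0//.
rewrite sqr_sqrtr ?addr_ge0 ?sqr_ge0//.
rewrite sqrrD !real_normK ?num_real//.
by rewrite lerD2r lerDl mulrn_wge0// mulr_ge0.
Qed.

Lemma abs_Re_le_normc {R : realType} (z : R[i]) : `|complex.Re z| <= normc z.
Proof.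
by case: z => a b /=; rewrite -sqrtr_sqr ler_sqrt ?lerDl ?sqr_ge0 ?addr_ge0 ?sqr_ge0.
Qed.

Lemma abs_Im_le_normc {R : realType} (z : R[i]) : `|complex.Im z| <= normc z.
Proof.
by case: z => a b /=; rewrite -sqrtr_sqr ler_sqrt ?lerDr ?sqr_ge0 ?addr_ge0 ?sqr_ge0.
Qed.

Lemma normc_ge0 {R : realType} (z : R[i]) : 0 <= normc z.
Proof. by case: z => a b; exact: sqrtr_ge0. Qed.

Lemma normc_real {R : realType} (r : R) : normc (r%:C)%C = `|r|.
Proof. by rewrite /= expr0n addr0 sqrtr_sqr. Qed.

Lemma normcX {R : realType} (z : R[i]) k : normc (z ^+ k) = normc z ^+ k.
Proof. by elim: k => [|k ih]; rewrite ?expr0 ?normc1// !exprS normcM ih. Qed.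

Lemma normc_sum {R : realType} (I : Type) (r : seq I) (P : pred I)
    (F : I -> R[i]) :
  normc (\sum_(i <- r | P i) F i) <= \sum_(i <- r | P i) normc (F i).
Proof.
elim/big_ind2 : _ => [|x a y b xa yb|//]; first by rewrite normc0.
exact: (le_trans (le_normcD _ _) (lerD xa yb)).
Qed.

(** Telescoping. As [M >= 1], the natural exponent [i - 1] may be raised to [i], which spares a
    separate case [i = 0]. *)
Lemma normc_subX {R : realType} (a b : R[i]) (M : R) i :
  1 <= M -> normc a <= M -> normc b <= M ->
  normc (a ^+ i - b ^+ i) <= i%:R * normc (a - b) * M ^+ i.
Proof.
move=> M1 aM bM; have M0 : 0 <= M by lra.
elim: i => [|i ih]; first by rewrite !expr0 subrr normc0 !mul0r.
have -> : a ^+ i.+1 - b ^+ i.+1 = a * (a ^+ i - b ^+ i) + (a - b) * b ^+ i.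
  by rewrite !exprS; ring.
apply: le_trans (le_normcD _ _) _; rewrite !normcM normcX.
rewrite -natr1 exprS.
have h1 : normc a * normc (a ^+ i - b ^+ i) <=
    M * (i%:R * normc (a - b) * M ^+ i).
  by rewrite ler_pM// normc_ge0.
have h2 : normc (a - b) * normc b ^+ i <= normc (a - b) * (M * M ^+ i).
  rewrite ler_wpM2l ?normc_ge0//.
  apply: (@le_trans _ _ (M ^+ i)); first by rewrite lerXn2r ?nnegrE ?normc_ge0.
  by rewrite ler_peMl// exprn_ge0.
lra.
Qed.

Definition cis {R : realType} (a : R) : R[i] := (cos a +i* sin a)%C.

Lemma cisD {R : realType} (a b : R) : cis (a + b) = cis a * cis b.
Proof.
by apply/eqP; rewrite eq_complex /= cosD sinD addrC [_ + sin a * _]addrC !eqxx.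
Qed.

Lemma normc_cis {R : realType} (a : R) : normc (cis a) = 1.
Proof. by rewrite /= cos2Dsin2 sqrtr1. Qed.

Definition multiplier {R : realType} (n : nat) (a : R) : R[i] :=
  1 + n%:R * (cis a - 1) ^+ 2.

Lemma normc_natr {R : realType} n : normc (n%:R : R[i]) = n%:R.
Proof.
by have := normc_real (n%:R : R); rewrite rmorph_nat normr_nat.
Qed.

(** [(cis a - 1) ^ 2 + a ^ 2] factors as [(cis a - 1 - i a) (cis a - 1 + i a)]; the factors are at
    most [2 a ^ 2] and [3 |a|], whence the 6. The other summand is the second-order error of the
    exponential. *)
Lemma normc_multiplierB {R : realType} n (a : R) :
  normc (multiplier n a - (expR (- (n%:R * a ^+ 2)))%:C%C) <=
  6 * n%:R * `|a| ^+ 3 + (n%:R * a ^+ 2) ^+ 2.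
Proof.
have -> : multiplier n a - (expR (- (n%:R * a ^+ 2)))%:C%C =
  n%:R * ((cis a - 1 - (a *i)%C) * (cis a - 1 + (a *i)%C))
    - (expR (- (n%:R * a ^+ 2)) - (1 - n%:R * a ^+ 2))%:C%C.
  have i2 : ((a *i)%C : R[i]) ^+ 2 = - ((a ^+ 2)%:C)%C.
    apply/eqP; rewrite eq_complex /=; apply/andP; split; apply/eqP; ring.
  rewrite -subr_sqr i2 /multiplier !(rmorphB, rmorphM, rmorph1, rmorph_nat) /=.
  ring.
apply: le_trans (le_normcD _ _) _; rewrite normcN normc_real.
apply: lerD; last by rewrite norm_expRN_le// mulr_ge0// sqr_ge0.
rewrite !normcM normc_natr [6 * _]mulrC -!mulrA ler_wpM2l//.
have a0 := normr_ge0 a.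
have -> : 6 * `|a| ^+ 3 = (2 * a ^+ 2) * (3 * `|a|).
  by rewrite -(real_normK (num_real a)); ring.
have hc1 := norm_cosB1_le a; have hs1 := norm_sinBid_le a.
have hc2 := norm_cosB1_le_abs a; have hs2 := norm_sin_le a.
apply: ler_pM; rewrite ?normc_ge0//; apply: le_trans (normc_le_abs _) _ => /=.
  by rewrite !subr0; lra.
rewrite !(subr0, addr0, oppr0).
by have := ler_normD (sin a) a; lra.
Qed.

(** One step costs at most [e], of order [p ^ 4 / n ^ 2] ([p >= 1] absorbs the cubic term), and
    there are at most [T n] steps. The multiplier may exceed 1 in modulus, but by at most [e];
    [(1 + e) ^ i <= expR (i e)] accounts for [expR X]. *)
Lemma multiplier_pow_bound {R : realType} n i (a p T X : R) :
  (0 < n)%N -> 1 <= p -> 0 <= T -> i%:R <= T * n%:R -> `|a| <= pi * p / n%:R ->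
  X = T * (6 * pi ^+ 3 + pi ^+ 4) * p ^+ 4 / n%:R ->
  normc (multiplier n a ^+ i - (expR (- (n%:R * a ^+ 2)))%:C%C ^+ i) <=
    X * expR X.
Proof.
move=> n0 p1 T0 iT ap XE.
have nR : 0 < n%:R :> R by rewrite ltr0n.
pose e : R := (6 * pi ^+ 3 + pi ^+ 4) * p ^+ 4 / n%:R ^+ 2.
have pi0 := @pi_ge0 R.
have p0 : 0 <= p by lra.
have e0 : 0 <= e.
  by rewrite divr_ge0 ?exprn_ge0// mulr_ge0 ?exprn_ge0// addr_ge0 ?mulr_ge0 ?exprn_ge0.
have a0 := normr_ge0 a.
have me : normc (multiplier n a - (expR (- (n%:R * a ^+ 2)))%:C%C) <= e.
  apply: le_trans (normc_multiplierB _ _) _.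
  have -> : e = 6 * n%:R * ((pi * p / n%:R) ^+ 3 * p) +
                (n%:R * (pi * p / n%:R) ^+ 2) ^+ 2.
    by rewrite /e; field; rewrite lt0r_neq0.
  have q0 : 0 <= pi * p / n%:R by rewrite divr_ge0// mulr_ge0.
  apply: lerD.
    rewrite ler_wpM2l//; apply: (@le_trans _ _ ((pi * p / n%:R) ^+ 3)).
      by rewrite lerXn2r ?nnegrE.
    by rewrite ler_peMr// exprn_ge0.
  have nn (b : R) : 0 <= n%:R * b ^+ 2 by rewrite mulr_ge0 ?sqr_ge0.
  rewrite lerXn2r ?nnegrE ?nn//.
  by rewrite ler_wpM2l// -(real_normK (num_real a)) lerXn2r ?nnegrE.
have q1 : normc ((expR (- (n%:R * a ^+ 2)))%:C%C : R[i]) <= 1.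
  rewrite normc_real ger0_norm ?expR_ge0// expR_le1 oppr_le0.
  by rewrite mulr_ge0// sqr_ge0.
have e1 : 1 <= 1 + e by lra.
have h1 : normc (multiplier n a) <= 1 + e.
  rewrite -[multiplier n a](subrK ((expR (- (n%:R * a ^+ 2)))%:C)%C).
  by apply: le_trans (le_normcD _ _) _; rewrite addrC lerD.
have h2 : normc ((expR (- (n%:R * a ^+ 2)))%:C%C : R[i]) <= 1 + e by lra.
apply: le_trans (normc_subX _ _ _ i e1 h1 h2) _.
have ieX : i%:R * e <= X.
  have -> : X = T * n%:R * e by rewrite XE /e; field; rewrite lt0r_neq0.
  by rewrite ler_wpM2r.
apply: ler_pM; rewrite ?mulr_ge0 ?normc_ge0 ?exprn_ge0//; first lra.
  by apply: le_trans ieX; exact: ler_wpM2l.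
apply: (@le_trans _ _ (expR e ^+ i)).
  by rewrite lerXn2r ?nnegrE ?expR_ge0 ?expR_ge1Dx//; lra.
by rewrite -expRM_natl ler_expR.
Qed.

(** * Riemann sums of Gaussians *)

(** A Riemann sum with step [h], over the nodes from [- N h] to [N h] inclusive, of the Fourier
    integral of a Gaussian; the sine part is odd and cancels over these nodes. *)
Definition gauss_sum {R : realType} (a h u : R) (N : nat) : R :=
  \sum_(k < N.*2.+1) h * expR (- (a * ((k%:R - N%:R) * h) ^+ 2)) *
    cos (u * ((k%:R - N%:R) * h)).

Section GaussSum.
Variables (R : realType) (a h : R) (N : nat).
Hypotheses (a0 : 0 < a) (h0 : 0 < h).
Let y (k : nat) : R := (k%:R - N%:R) * h.
(** [psi u] vanishes at infinity, so the integral of its derivative [dpsi u] is 0: this is the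
    integration by parts behind the differential equation of the Gaussian integral. *)
Let psi (u y : R) := expR (- (a * y ^+ 2)) * sin (u * y).
Let dpsi (u y : R) := expR (- (a * y ^+ 2)) *
  (u * cos (u * y) - 2 * a * y * sin (u * y)).
Let ddpsi (u y : R) := expR (- (a * y ^+ 2)) *
  ((4 * a ^+ 2 * y ^+ 2 - u ^+ 2 - 2 * a) * sin (u * y)
   - 4 * a * y * u * cos (u * y)).

Lemma is_derive_psi u (x : R) : is_derive x 1 (psi u) (dpsi u x).
Proof.
rewrite /psi /dpsi; apply: is_derive_eq.
rewrite /GRing.scale /=; ring.
Qed.

Lemma is_derive_dpsi u (x : R) : is_derive x 1 (dpsi u) (ddpsi u x).
Proof.
rewrite /dpsi /ddpsi; apply: is_derive_eq.
rewrite /GRing.scale /=; ring.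
Qed.

(** Taylor at order two, by two uses of the mean value inequality. The Gaussian factor of the second
    derivative is just bounded by 1: the powers of [L] that remain are harmless, since summation
    over the nodes still leaves a small factor [h]. *)
Lemma psi_step u (x L : R) : `|x| <= L -> `|x + h| <= L ->
  `|psi u (x + h) - psi u x - h * dpsi u x| <=
  h ^+ 2 * ((2 * a * L + `|u|) ^+ 2 + 2 * a).
Proof.
move=> xL xhL; have L0 : 0 <= L by apply: le_trans xL.
set C := (_ ^+ 2 + _).
have inL z : x <= z <= x + h -> `|z| <= L.
  by move: xL xhL; rewrite !ler_norml => /andP[? ?] /andP[? ?] /andP[? ?]; lra.
have ddC z : x <= z <= x + h -> `|ddpsi u z| <= C.
  move=> /inL zL; rewrite normrM -[C]mul1r ler_pM//.
    rewrite ger0_norm ?expR_ge0// expR_le1 oppr_le0 mulr_ge0 ?sqr_ge0//.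
    exact: ltW.
  apply: le_trans (ler_normB _ _) _; rewrite !normrM.
  have sm := sin_max (u * z); have cm := cos_max (u * z).
  apply: (@le_trans _ _ (`|4 * a ^+ 2 * z ^+ 2 - u ^+ 2 - 2 * a| +
      `|4| * `|a| * `|z| * `|u|)).
    by apply: lerD; rewrite ler_piMr// ?mulr_ge0.
  have z2 : z ^+ 2 <= L ^+ 2.
    by rewrite -(real_normK (num_real z)) lerXn2r ?nnegrE.
  have h1 : `|4 * a ^+ 2 * z ^+ 2 - u ^+ 2 - 2 * a| <=
      4 * a ^+ 2 * L ^+ 2 + `|u| ^+ 2 + 2 * a.
    rewrite real_normK ?num_real//.
    have : 4 * a ^+ 2 * z ^+ 2 <= 4 * a ^+ 2 * L ^+ 2.
      by rewrite ler_wpM2l// mulr_ge0// sqr_ge0.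
    have : 0 <= 4 * a ^+ 2 * z ^+ 2 by rewrite mulr_ge0 ?sqr_ge0// mulr_ge0 ?sqr_ge0.
    have : 0 <= u ^+ 2 by rewrite sqr_ge0.
    move: (a0) => a1 q1 q2 q3; rewrite ler_norml; apply/andP; clear -a1 q1 q2 q3.
 split; lra.
  have h2 : `|4| * `|a| * `|z| * `|u| <= 4 * a * L * `|u|.
    by rewrite ler_wpM2r// ger0_norm// (gtr0_norm a0) ler_wpM2l// mulr_ge0// ltW.
  rewrite /C; lra.
have xh : x <= x + h by rewrite lerDl ltW.
have C0 : 0 <= C by apply: le_trans (ddC x _); rewrite ?lexx.
have -> : psi u (x + h) - psi u x - h * dpsi u x =
  (psi u (x + h) - dpsi u x * (x + h)) - (psi u x - dpsi u x * x) by ring.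
have -> : h ^+ 2 * C = (C * h) * (x + h - x) by ring.
apply: (@derive_bound R (fun z => psi u z - dpsi u x * z)
  (fun z => dpsi u z - dpsi u x)) => // [z|z /andP[xz zh]].
  have ? := is_derive_psi u z; apply: is_derive_eq.
  by rewrite /GRing.scale /=; ring.
have /= := @derive_bound R (dpsi u) (ddpsi u) x z C xz (is_derive_dpsi u).
move=> /(_ _)/le_trans; apply.
  by move=> v /andP[xv vz]; apply: ddC; rewrite xv (le_trans vz).
by rewrite ler_wpM2l//; lra.
Qed.

(** The sum of the increments of [psi] telescopes. Both end values lie at distance at least [N h]
    from 0; the last increment ends at [(N + 1) h], hence the radius in the remainder. *)
Lemma psi_sum u : `|\sum_(k < N.*2.+1) h * dpsi u (y k)| <=
  2 * expR (- (a * (N%:R * h) ^+ 2)) + (N.*2.+1)%:R * (h ^+ 2 *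
    ((2 * a * (N.+1%:R * h) + `|u|) ^+ 2 + 2 * a)).
Proof.
set C := h ^+ 2 * _.
have yS k : y k.+1 = y k + h by rewrite /y -natr1; ring.
have -> : \sum_(k < N.*2.+1) h * dpsi u (y k) =
    (psi u (y N.*2.+1) - psi u (y 0)) -
    \sum_(k < N.*2.+1) (psi u (y k.+1) - psi u (y k) - h * dpsi u (y k)).
  rewrite sumrB opprB addrC -[X in _ = X + _]addrC.
  rewrite -(big_mkord xpredT (fun k => psi u (y k.+1) - psi u (y k))).
  by rewrite telescope_sumr// addrC addrNK.
apply: le_trans (ler_normB _ _) _; apply: lerD.
  apply: le_trans (ler_normB _ _) _.
  have hN (z : R) : (N%:R * h) ^+ 2 <= z ^+ 2 ->
      `|psi u z| <= expR (- (a * (N%:R * h) ^+ 2)).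
    move=> zN; rewrite normrM ger0_norm ?expR_ge0//.
    apply: (@le_trans _ _ (expR (- (a * z ^+ 2)))).
      by rewrite ler_piMr ?expR_ge0// sin_max.
    by rewrite ler_expR lerN2 ler_pM2l.
  rewrite mulrDl !mul1r; apply: lerD; apply: hN.
    have -> : y N.*2.+1 = N.+1%:R * h by rewrite /y -addnn -addSn natrD addrK.
    by rewrite lerXn2r ?nnegrE ?mulr_ge0 ?(ltW h0)// ler_pM2r// ler_nat.
  by rewrite /y sub0r mulNr sqrrN.
apply: le_trans (ler_norm_sum _ _ _) _.
rewrite -[X in _ <= X%:R * _](card_ord N.*2.+1) mulrC mulr_natr -sumr_const.
apply: ler_sum => k _; rewrite yS.
have kN : k%:R <= N%:R + N%:R :> R by rewrite -natrD addnn ler_nat -ltnS.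
have := ler0n R k; have := ler0n R N => N0 k0; apply: psi_step.
  rewrite /y normrM (gtr0_norm h0) ler_pM2r// ler_norml -natr1.
  by apply/andP; split; lra.
rewrite -yS /y normrM (gtr0_norm h0) ler_pM2r// ler_norml -!natr1.
by apply/andP; split; lra.
Qed.

(** With an integral in place of the sum, the [dpsi] term would vanish and this would be
    the differential equation of the Fourier transform of a Gaussian. *)
Lemma gauss_sum_ode (u : R) : is_derive u 1 (fun v : R => gauss_sum a h v N)
  ((2 * a)^-1 * (\sum_(k < N.*2.+1) h * dpsi u (y k)) -
   u / (2 * a) * gauss_sum a h u N).
Proof.
have -> : (fun v : R => gauss_sum a h v N) =
    \sum_(k < N.*2.+1) (fun v : R => h * expR (- (a * (y k) ^+ 2)) * cos (v * y k)).
  by apply/funext => v; rewrite fct_sumE.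
have -> : (2 * a)^-1 * (\sum_(k < N.*2.+1) h * dpsi u (y k)) -
   u / (2 * a) * gauss_sum a h u N =
  \sum_(k < N.*2.+1) (- (h * expR (- (a * (y k) ^+ 2)) * (y k * sin (u * y k)))).
  rewrite /gauss_sum !mulr_sumr -sumrB; apply: eq_bigr => k _.
  by rewrite /dpsi -/(y k); field; rewrite lt0r_neq0.
apply: is_derive_sum => k; apply: is_derive_eq.
rewrite /GRing.scale /=; ring.
Qed.

(** [E] is the integrating factor of the equation. It increases on [[0, u]], so its bound [E u]
    cancels in the final division and the error is not amplified for large [u]. *)
Lemma gauss_sum_le u : `|gauss_sum a h u N - expR (- (u ^+ 2 / (4 * a))) *
    gauss_sum a h 0 N| <=
  `|u| * ((2 * a)^-1 *
  (2 * expR (- (a * (N%:R * h) ^+ 2)) + (N.*2.+1)%:R * (h ^+ 2 *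
    ((2 * a * (N.+1%:R * h) + `|u|) ^+ 2 + 2 * a)))).
Proof.
wlog u0 : u / 0 <= u => [hw|].
  have [|/ltW u0] := leP 0 u; first exact: hw.
  have -> : gauss_sum a h u N = gauss_sum a h (- u) N.
    by apply: eq_bigr => k _; rewrite mulNr cosN.
  by rewrite -(sqrrN u) -(normrN u) hw// oppr_ge0.
set D := (2 * a)^-1 * _.
pose E (v : R) := expR (v ^+ 2 / (4 * a)).
have a2 : 0 < (2 * a)^-1 by rewrite invr_gt0 mulr_gt0.
have a4 : 0 <= (4 * a)^-1 by rewrite invr_ge0 mulr_ge0// ltW.
have := @derive_bound R (fun v => E v * gauss_sum a h v N)
  (fun v => E v * ((2 * a)^-1 * (\sum_(k < N.*2.+1) h * dpsi v (y k))))
  0 u (E u * D) u0.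
have -> : E 0 = 1 by rewrite /E expr0n mul0r expR0.
rewrite mul1r subr0 (ger0_norm u0) => /(_ _ _) EB.
have E0 := expR_gt0 (u ^+ 2 / (4 * a)).
rewrite -(@ler_pM2l _ (E u))// -[X in X * `|_|](gtr0_norm E0) -normrM mulrBr.
rewrite mulrA -expRD subrr expR0 mul1r mulrCA [u * _]mulrC -mulrA mulrA.
apply: le_trans (EB _ _) _ => [v|v /andP[v0 vu]|]; last by rewrite mulrCA mulrA.
  have ? := gauss_sum_ode v; rewrite /E; apply: is_derive_eq.
  by rewrite /GRing.scale /=; field; rewrite lt0r_neq0.
rewrite normrM ger0_norm ?expR_ge0// ler_pM ?expR_ge0//.
  by rewrite ler_expR ler_wpM2r// lerXn2r ?nnegrE.
rewrite normrM gtr0_norm// ler_pM2l//; apply: le_trans (psi_sum v) _.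
rewrite (ger0_norm v0) (ger0_norm u0) lerD2l ler_wpM2l// ler_wpM2l ?sqr_ge0// lerD2r.
have q0 : 0 <= 2 * a * (N.+1%:R * h) by rewrite !mulr_ge0// ltW.
by rewrite lerXn2r ?nnegrE ?addr_ge0// lerD2l.
Qed.
End GaussSum.

(** * Riemann sums and dominated convergence *)

Section RiemannSum.
Variable R : realType.
Local Notation mu := (@lebesgue_measure R).
Local Open Scope classical_set_scope.

(** Up to a constant this is the density of the centred normal law of variance [1 / (2 a)]. *)
Lemma integrable_gauss (a : R) : 0 < a ->
  mu.-integrable setT (fun z => (expR (- (a * z ^+ 2)))%:E).
Proof.
move=> a0.
pose s : R := Num.sqrt (2 * a)^-1.
have a2 : 0 < (2 * a)^-1 by rewrite invr_gt0 mulr_gt0.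
have s0 : s != 0 by rewrite gt_eqF// sqrtr_gt0.
have := @integrable_normal_pdf R 0 s.
rewrite normal_pdfE//.
move/(integrableZl measurableT (normal_peak s)^-1).
apply: eq_integrable => //= z _.
rewrite -EFinM mulrA mulVf ?mul1r; last by rewrite gt_eqF// normal_peak_gt0.
rewrite /normal_fun subr0 /s sqr_sqrtr ?ltW//; congr (expR _)%:E.
by rewrite mulr2n; field; rewrite lt0r_neq0.
Qed.

Lemma integral_gauss (a : R) : 0 < a ->
  \int[mu]_z expR (- (a * z ^+ 2)) = Num.sqrt (pi / a).
Proof.
move=> a0.
pose s : R := Num.sqrt (2 * a)^-1.
have a2 : 0 < (2 * a)^-1 by rewrite invr_gt0 mulr_gt0.
have s0 : s != 0 by rewrite gt_eqF// sqrtr_gt0.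
have s2 : s ^+ 2 = (2 * a)^-1 by rewrite /s sqr_sqrtr ?ltW.
have p0 := normal_peak_gt0 s0.
have -> : \int[mu]_z expR (- (a * z ^+ 2)) =
    \int[mu]_z ((normal_peak s)^-1 * normal_pdf 0 s z).
  apply: eq_Rintegral => z _; rewrite normal_pdfE// mulrA mulVf ?mul1r ?gt_eqF//.
  rewrite /normal_fun subr0 s2; congr expR.
  by rewrite mulr2n; field; rewrite lt0r_neq0.
rewrite RintegralZl//; last exact: integrable_normal_pdf.
rewrite /Rintegral integral_normal_pdf mulr1 /normal_peak invrK s2.
by congr Num.sqrt; rewrite mulr2n; field; rewrite lt0r_neq0.
Qed.

Definition riemann_sum (n w : nat) (phi : R -> R) : R :=
  \sum_(j < (w * n).*2) n%:R^-1 * phi ((j%:Z - (w * n)%:Z)%:~R / n%:R).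

Let cell (n : nat) (m : int) : set R := `[m%:~R / n%:R, (m + 1)%:~R / n%:R[%classic.

Let step_fun (n w : nat) (phi : R -> R) (z : R) : R :=
  \sum_(j < (w * n).*2) phi ((j%:Z - (w * n)%:Z)%:~R / n%:R) *
    \1_(cell n (j%:Z - (w * n)%:Z)) z.

Lemma indic_cell n (m : int) (z : R) : (0 < n)%N ->
  \1_(cell n m) z = (Num.floor (n%:R * z) == m)%:R :> R.
Proof.
move=> n0; have nR : 0 < n%:R :> R by rewrite ltr0n.
rewrite indicE; congr (nat_of_bool _)%:R.
rewrite floor_eq /cell /= [n%:R * z]mulrC -ler_pdivrMr// -ltr_pdivlMr//.
by apply/idP/idP; rewrite inE /= in_itv.
Qed.

Lemma integrable_step_fun n w phi :
  mu.-integrable setT (EFin \o step_fun n w phi).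
Proof.
rewrite [X in mu.-integrable _ X](_ : _ = fun z => (\sum_(j < (w * n).*2)
  (phi ((j%:Z - (w * n)%:Z)%:~R / n%:R))%:E *
    (\1_(cell n (j%:Z - (w * n)%:Z)) z)%:E)%E); last first.
  by apply/funext => z /=; rewrite /step_fun -sumEFin.
apply: integrable_sum => // j _; apply: integrableZl => //.
exact: integrable_indic_itv.
Qed.

Lemma integral_step_fun n w phi : (0 < n)%N ->
  \int[mu]_z step_fun n w phi z = riemann_sum n w phi.
Proof.
move=> n0; have nR : 0 < n%:R :> R by rewrite ltr0n.
transitivity (fine (\int[mu]_z (\sum_(j < (w * n).*2)
  (phi ((j%:Z - (w * n)%:Z)%:~R / n%:R))%:E *
    (\1_(cell n (j%:Z - (w * n)%:Z)) z)%:E))%E).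
  by congr fine; apply: eq_integral => z _; rewrite /step_fun -sumEFin.
rewrite integral_sum//; last first.
  by move=> j; apply: integrableZl => //; exact: integrable_indic_itv.
rewrite (eq_bigr (fun j : 'I_((w * n).*2) =>
  (n%:R^-1 * phi ((j%:Z - (w * n)%:Z)%:~R / n%:R))%:E)); last first.
  move=> j _; rewrite integralZl//; last exact: integrable_indic_itv.
  rewrite integral_indic//=; last exact: measurable_itv.
  rewrite setIT /cell lebesgue_measure_itv/= lte_fin.
  rewrite ltr_pM2r ?invr_gt0// ltr_int ltzD1 lexx -EFinB -EFinM mulrC.
  by congr (_ * _)%:E; rewrite -mulrBl intrD addrAC subrr add0r mul1r.
by rewrite -[RHS]/(fine (riemann_sum n w phi)%:E) -sumEFin.
Qed.

(** Both alternatives obey the domination, and the second is excluded as soon as [w > |z|], which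
    leaves pointwise convergence at the left node of the cell. *)
Lemma step_fun_cases n w phi (z : R) : (0 < n)%N ->
  let y := (Num.floor (n%:R * z))%:~R / n%:R in
  (step_fun n w phi z = phi y) \/
  (step_fun n w phi z = 0 /\ ~ (- w%:R <= z < w%:R)).
Proof.
move=> n0; have nR : 0 < n%:R :> R by rewrite ltr0n.
set m := Num.floor _ => y.
have stepE : step_fun n w phi z = \sum_(j < (w * n).*2)
    phi ((j%:Z - (w * n)%:Z)%:~R / n%:R) * (m == j%:Z - (w * n)%:Z)%:R.
  by apply: eq_bigr => j _; rewrite indic_cell.
have [mw|mw] := boolP ((- (w * n)%:Z <= m) && (m < (w * n)%:Z)).
  left; case/andP: mw => m1 m2.
  have mw : (absz (m + (w * n)%:Z)%R < (w * n).*2)%N by lia.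
  rewrite stepE (bigD1 (Ordinal mw))//= big1 ?addr0.
    have -> : (absz (m + (w * n)%:Z)%R)%:Z - (w * n)%:Z = m by lia.
    by rewrite eqxx mulr1.
  move=> j jm; rewrite (_ : (m == _) = false) ?mulr0//.
  by apply/negbTE; apply: contra jm => /eqP mj; apply/eqP/val_inj => /=; lia.
right; split.
  rewrite stepE big1// => j _; rewrite (_ : (m == _) = false) ?mulr0//.
  by apply/negbTE; apply: contra mw => /eqP ->; have := ltn_ord j; lia.
move=> /andP[wz zw]; move/negP: mw; apply; apply/andP; split.
  rewrite floor_ge_int intrN -pmulrn natrM -mulNr mulrC.
  by rewrite ler_pM2l.
rewrite floor_lt_int -pmulrn natrM [_ * n%:R]mulrC.
by rewrite ltr_pM2l.
Qed.

Lemma cell_node n (z : R) : (0 < n)%N ->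
  z - n%:R^-1 < (Num.floor (n%:R * z))%:~R / n%:R <= z.
Proof.
move=> n0; have nR : 0 < n%:R :> R by rewrite ltr0n.
rewrite ler_pdivrMr// ltr_pdivlMr// mulrBl mulVf ?gt_eqF//.
by have /andP[] := floor_itv (n%:R * z); rewrite intrD mulrC => *; apply/andP; split; lra.
Qed.

Section Limit.
Variable h : R -> R.
Hypotheses (h_cont : continuous h)
  (h_growth : forall e : R, 0 < e ->
    exists C : R, forall x, `|h x| <= C * expR (e * x ^+ 2)).

Let phi (a x z : R) : R := h z * expR (- (a * (x - z) ^+ 2)).

(** The growth of [h] is taken at rate [b / 4], half of what remains of the Gaussian after
    [(x - y) ^ 2 >= y ^ 2 / 2 - x ^ 2]. The node [y] of the cell of [z] lies in [[z - 1, z]], so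
    [y ^ 2 >= z ^ 2 / 2 - 1] leaves the rate [b / 8]. *)
Lemma phi_dominated (b X : R) : 0 < b -> exists2 C : R, 0 <= C &
  forall a x z y : R, b <= a -> `|x| <= X -> z - 1 <= y <= z ->
  `|phi a x y| <= C * expR (- (b / 8 * z ^+ 2)).
Proof.
move=> b0; have b4 : 0 < b / 4 by rewrite divr_gt0.
have [C hC] := h_growth _ b4.
have C0 : 0 <= C.
  by have := hC 0; rewrite expr0n mulr0 expR0 mulr1; apply: le_trans.
exists (C * expR (b / 4 + b * X ^+ 2)); first by rewrite mulr_ge0 ?expR_ge0.
move=> a x z y ba xX /andP[zy yz].
rewrite -mulrA -expRD normrM [X in _ * X]ger0_norm ?expR_ge0//.
apply: (@le_trans _ _ (C * expR (b / 4 * y ^+ 2) * expR (- (a * (x - y) ^+ 2)))).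
  by rewrite ler_wpM2r ?expR_ge0.
rewrite -mulrA -expRD ler_wpM2l// ler_expR.
have x2 : x ^+ 2 <= X ^+ 2.
  by rewrite -(real_normK (num_real x)) lerXn2r ?nnegrE ?(le_trans _ xX).
have s0 : 0 <= (x - y) ^+ 2 by rewrite sqr_ge0.
have h1 : b * (x - y) ^+ 2 <= a * (x - y) ^+ 2 by rewrite ler_wpM2r.
have h2 : y ^+ 2 / 2 - x ^+ 2 <= (x - y) ^+ 2.
  have : 0 <= (2 * x - y) ^+ 2 by rewrite sqr_ge0.
  lra.
have h3 : z ^+ 2 / 2 - 1 <= y ^+ 2.
  have : (z - y) ^+ 2 <= 1 by rewrite expr_le1//; lra.
  have : 0 <= (2 * y - z) ^+ 2 by rewrite sqr_ge0.
  lra.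
have h4 : b * (y ^+ 2 / 2 - x ^+ 2) <= b * (x - y) ^+ 2 by rewrite ler_pM2l.
have h5 : b * (z ^+ 2 / 2 - 1) <= b * y ^+ 2 by rewrite ler_pM2l.
have h6 : b * x ^+ 2 <= b * X ^+ 2 by rewrite ler_pM2l.
lra.
Qed.

Lemma riemann_sum_cvg (a0 x0 b X : R) (n_ w_ : nat -> nat) (x_ a_ : nat -> R) :
  0 < b -> (forall k, b <= a_ k) -> (forall k, `|x_ k| <= X) ->
  (forall k, (k < n_ k)%N) -> (forall k, (k <= w_ k)%N) ->
  x_ @ \oo --> x0 -> a_ @ \oo --> a0 ->
  riemann_sum (n_ k) (w_ k) (phi (a_ k) (x_ k)) @[k --> \oo] -->
    \int[mu]_z phi a0 x0 z.
Proof.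
move=> b0 ba xX kn kw xx0 aa0.
have n0 k : (0 < n_ k)%N by rewrite (leq_ltn_trans _ (kn k)).
have [C C0 dom] := phi_dominated b X b0.
have b8 : 0 < b / 8 by rewrite divr_gt0.
pose D (z : R) := C * expR (- (b / 8 * z ^+ 2)).
have iD : mu.-integrable setT (EFin \o D).
  by apply: (@integrableZl _ _ _ mu setT measurableT C) (integrable_gauss _ b8).
pose f_ k := EFin \o step_fun (n_ k) (w_ k) (phi (a_ k) (x_ k)).
have node k (z : R) := cell_node _ z (n0 k).
have node1 k (z : R) : z - 1 <= (Num.floor ((n_ k)%:R * z))%:~R / (n_ k)%:R <= z.
  have /andP[zy ->] := node k z; rewrite andbT.
  apply: le_trans (ltW zy); rewrite lerD2l lerN2 invf_le1 ?ltr0n//.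
  by rewrite ler1n.
have f_dom k (z : R) : setT z -> (`|f_ k z| <= (EFin \o D) z)%E.
  move=> _; rewrite /f_ /= lee_fin.
  have [->|[-> _]] := step_fun_cases _ (w_ k) (phi (a_ k) (x_ k)) z (n0 k).
    exact: dom.
  by rewrite normr0 mulr_ge0// expR_ge0.
have ncvg (z : R) : (Num.floor ((n_ k)%:R * z))%:~R / (n_ k)%:R @[k --> \oo] --> z.
  apply: (@squeeze_cvgr _ _ _ _ (fun k => z - k.+1%:R^-1) (fun=> z)).
  - apply: nearW => k; have /andP[zy ->] := node k z; rewrite andbT.
    apply: le_trans (ltW zy); rewrite lerD2l lerN2 lef_pV2 ?posrE ?ltr0n//.
    by rewrite ler_nat.
  - rewrite -[X in _ --> X]subr0; apply: cvgB; first exact: cvg_cst.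
    exact: cvg_harmonic.
  - exact: cvg_cst.
have f_cvg (z : R) : setT z -> f_ ^~ z @ \oo --> (phi a0 x0 z)%:E.
  move=> _; apply/cvg_EFin; first exact: nearW.
  rewrite /f_ /=.
  apply: (@cvg_trans _ (phi (a_ k) (x_ k)
      ((Num.floor ((n_ k)%:R * z))%:~R / (n_ k)%:R) @[k --> \oo])).
    apply: near_eq_cvg; near=> k => /=.
    have [->//|[_ []]] := step_fun_cases _ (w_ k) (phi (a_ k) (x_ k)) z (n0 k).
    have zk : `|z| < k%:R by near: k; exact: nbhs_infty_gtr.
    have kwk : k%:R <= (w_ k)%:R :> R by rewrite ler_nat.
    by move: zk; rewrite ltr_norml => /andP[? ?]; apply/andP; split; lra.
  apply: cvgM; first by apply: continuous_cvg; [exact: h_cont|exact: ncvg].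
  apply: continuous_cvg; first exact: continuous_expR.
  apply: cvgN; apply: cvgM => //.
  by rewrite expr2; under eq_fun do rewrite expr2; apply: cvgM; apply: cvgB.
have f_meas k := measurable_int _
  (integrable_step_fun (n_ k) (w_ k) (phi (a_ k) (x_ k))).
have mphi := measurable_realfun.emeasurable_fun_cvg _ _ f_meas f_cvg.
have [iphi _] := dominated_convergence measurableT f_meas mphi
  (aeW mu f_cvg) iD (aeW mu (fun z k => f_dom k z)).
rewrite -[X in _ --> X](fineK (integrable_fin_num measurableT iphi)).
move=> /fine_cvg; apply: cvg_trans; apply: near_eq_cvg; near=> k.
by rewrite -integral_step_fun.
Unshelve. all: by end_near. Qed.

(** If no threshold worked, a bad choice of parameters for each [k] would give sequences
    contradicting [riemann_sum_cvg]. The threshold form is the one that transfers. *)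
Lemma riemann_sum_lim (a0 x0 e : R) : 0 < a0 -> 0 < e ->
  exists (M : nat) (d : R), 0 < d /\ forall (n w : nat) (x a : R),
    (M <= n)%N -> (M <= w)%N -> `|x - x0| < d -> `|a - a0| < d ->
    `|riemann_sum n w (phi a x) - \int[mu]_z phi a0 x0 z| < e.
Proof.
move=> a00 e0; apply: contrapT => nex.
(* The extra clause [|s.2 - a0| < a0 / 2] keeps the rates above [a0 / 2], as the domination
   requires. *)
have bad (k : nat) : exists s : nat * nat * R * R,
    [/\ (k < s.1.1.1)%N, (k < s.1.1.2)%N, `|s.1.2 - x0| < k.+1%:R^-1,
      `|s.2 - a0| < k.+1%:R^-1 /\ `|s.2 - a0| < a0 / 2 &
      e <= `|riemann_sum s.1.1.1 s.1.1.2 (phi s.2 s.1.2) -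
             \int[mu]_z phi a0 x0 z|].
  apply: contrapT => ns; apply: nex.
  exists k.+1, (Num.min k.+1%:R^-1 (a0 / 2)); split.
    by rewrite lt_min invr_gt0 ltr0n divr_gt0.
  move=> n w x a kn kw; rewrite !lt_min => /andP[xk _] /andP[ak aa].
  by rewrite ltNge; apply/negP => es; apply: ns; exists (n, w, x, a).
have [s sP] := choice bad.
have k1 (k : nat) : k.+1%:R^-1 <= 1 :> R by rewrite invf_le1 ?ler1n ?ltr0n.
have lim_of (y_ : nat -> R) (y0 : R) : (forall k : nat, `|y_ k - y0| < k.+1%:R^-1) ->
    y_ @ \oo --> y0.
  move=> yk; apply: (@squeeze_cvgr _ _ _ _ (fun k => y0 - k.+1%:R^-1)
    (fun k => y0 + k.+1%:R^-1)).
  - apply: nearW => k /=; have := yk k; move: (k.+1%:R^-1) => r.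
    by rewrite ltr_norml => /andP[? ?]; apply/andP; split; lra.
  - rewrite -[X in _ --> X]subr0; apply: cvgB; first exact: cvg_cst.
    exact: cvg_harmonic.
  - rewrite -[X in _ --> X]addr0; apply: cvgD; first exact: cvg_cst.
    exact: cvg_harmonic.
have : riemann_sum (s k).1.1.1 (s k).1.1.2 (phi (s k).2 (s k).1.2) @[k --> \oo]
    --> \int[mu]_z phi a0 x0 z.
  apply: (@riemann_sum_cvg a0 x0 (a0 / 2) (`|x0| + 1)).
  - by rewrite divr_gt0.
  - move=> k; have [_ _ _ [_ +] _] := sP k.
    by rewrite ltr_norml => /andP[? ?]; lra.
  - move=> k; have [_ _ + _ _] := sP k => xk.
    rewrite -[X in `|X|](subrK x0); apply: le_trans (ler_normD _ _) _.
    by rewrite addrC lerD2l (le_trans (ltW xk)).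
  - by move=> k; have [] := sP k.
  - by move=> k; have [_ /ltnW] := sP k.
  - by apply: lim_of => k; have [] := sP k.
  - by apply: lim_of => k; have [_ _ _ []] := sP k.
move=> /cvgrPdist_lt/(_ _ e0)[N _ /(_ N (leqnn N)) /=].
by rewrite distrC ltNge; have [_ _ _ _ ->] := sP N.
Qed.
End Limit.
End RiemannSum.

(** * The discrete heat equation *)

Section Growth.
Variables (R : realType) (g : R -> R[i]).
Hypothesis g_cont : continuous (g : R -> R[i]^o).

Lemma continuous_Re : continuous (fun x => complex.Re (g x)).
Proof.
move=> x; apply/cvgrPdist_lt => e e0.
have e0c : 0 < (e%:C)%C :> R[i] by rewrite (ltcR 0).
have /cvgrPdist_lt/(_ _ e0c) := g_cont x.
apply: filterS => y; rewrite ltcR; apply: le_lt_trans.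
by apply: le_trans (abs_Re_le_normc _); rewrite raddfB.
Qed.

Lemma continuous_Im : continuous (fun x => complex.Im (g x)).
Proof.
move=> x; apply/cvgrPdist_lt => e e0.
have e0c : 0 < (e%:C)%C :> R[i] by rewrite (ltcR 0).
have /cvgrPdist_lt/(_ _ e0c) := g_cont x.
apply: filterS => y; rewrite ltcR; apply: le_lt_trans.
by apply: le_trans (abs_Im_le_normc _); rewrite raddfB.
Qed.

(** Far out, [|B| |x| ^ rho <= e x ^ 2] because [|x| ^ (2 - rho) >= |B| / e]; on the remaining
    compact segment [g] is bounded. The growth hypothesis is used only in this form. *)
Lemma subquadratic_growth (A B rho : R) : rho < 2 ->
  (forall x : R, `|g x| <= (A * expR (B * `|x| `^ rho))%:C%C) ->
  forall e : R, 0 < e ->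
    exists C : R, forall x, normc (g x) <= C * expR (e * x ^+ 2).
Proof.
move=> rho2 gAB e e0.
have A0 : 0 <= A.
  have := le_trans (normr_ge0 _) (gAB 0).
  by rewrite (lecR 0) pmulr_lge0 ?expR_gt0.
pose r := 2 - rho; have r0 : 0 < r by rewrite subr_gt0.
(* The [+ 1] makes the radius positive, so that [x] is nonzero outside and the powers of [|x|]
   multiply. *)
pose X := (`|B| / e) `^ r^-1 + 1.
have X0 : 0 < X by rewrite ltr_wpDl// powR_ge0.
pose f x := `|complex.Re (g x)| + `|complex.Im (g x)|.
have f_cont : continuous f.
  move=> x; apply: cvgD; apply: cvg_norm.
    exact: continuous_Re.
  exact: continuous_Im.
have [||c _ fc] := @EVT_max R f (- X) X; first by lra.
  exact: continuous_subspaceT.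
exists (A + f c) => x.
have fc0 : 0 <= f c by rewrite addr_ge0.
have ex1 : 1 <= expR (e * x ^+ 2).
  by rewrite -expR0 ler_expR mulr_ge0 ?sqr_ge0// ltW.
have [xX|Xx] := leP `|x| X.
  apply: (@le_trans _ _ (f c)).
    by apply: le_trans (normc_le_abs _) _; apply: fc; rewrite in_itv /= -ler_norml.
  by rewrite -[X in X <= _]mulr1 ler_pM// lerDr.
have := gAB x; rewrite lecR => /le_trans; apply.
have x0 : 0 < `|x| by apply: lt_trans Xx.
rewrite ler_pM ?expR_ge0 ?lerDl// ler_expR.
apply: (@le_trans _ _ (`|B| * `|x| `^ rho)).
  by rewrite ler_wpM2r ?powR_ge0// ler_norm.
have -> : x ^+ 2 = `|x| `^ r * `|x| `^ rho.
  rewrite -powRD; last by rewrite (gt_eqF x0) implybT.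
  by rewrite /r subrK powR_mulrn ?real_normK ?num_real// ltW.
rewrite mulrA ler_wpM2r ?powR_ge0// mulrC -ler_pdivrMr//.
have Be : 0 <= `|B| / e by rewrite divr_ge0// ltW.
have -> : `|B| / e = ((`|B| / e) `^ r^-1) `^ r.
  by rewrite -powRrM mulVf ?powRr1// gt_eqF.
rewrite ge0_ler_powR ?nnegrE ?powR_ge0// ?(ltW r0)//.
by apply: ltW; apply: le_lt_trans Xx; rewrite /X lerDl.
Qed.
End Growth.

(** * Windows and shifts of symmetric finite sums *)

Lemma sum_window (V : nmodType) (F : nat -> V) (s m N : nat) : (s + m <= N)%N ->
  \sum_(k < N) (if (s <= k < s + m)%N then F k else 0) = \sum_(k < m) F (s + k)%N.
Proof.
move=> smN.
rewrite -(big_mkord xpredT (fun k => if (s <= k < s + m)%N then F k else 0)).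
rewrite -(big_mkord xpredT (fun k => F (s + k)%N)).
rewrite (@big_cat_nat _ _ _ s)//=; last by lia.
rewrite [X in X + _]big_nat_cond big1 ?add0r; last first.
  by move=> k /andP[/andP[_ ks] _]; rewrite leqNgt ks.
rewrite (@big_cat_nat _ _ _ (s + m)%N)//=; last by lia.
rewrite [X in _ + X]big_nat_cond [X in _ + X]big1 ?addr0; last first.
  by move=> k /andP[/andP[ks _] _]; rewrite [(k < _)%N]ltnNge ks andbF.
rewrite -{1}[s]add0n big_addn (_ : s + m - s = m)%N; last by lia.
rewrite big_nat_cond [RHS]big_nat_cond; apply: eq_bigr => k /andP[km _].
by rewrite addnC ifT//; lia.
Qed.

Lemma symsum_window {R : realType} (F : int -> R[i]) (W N : nat) : (W <= N)%N ->
  symsum N (fun j => if (- W%:Z <= j) && (j < W%:Z) then F j else 0) = symsum W F.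
Proof.
move=> WN; rewrite /symsum.
transitivity (\sum_(k < N.*2) (if (N - W <= k < N - W + W.*2)%N
    then F (k%:Z - N%:Z) else 0)).
  by apply: eq_bigr => k _; congr (if _ then _ else _); lia.
rewrite (sum_window _ (fun k : nat => F (k%:Z - N%:Z))); last lia.
by apply: eq_bigr => k _; congr F; lia.
Qed.

Lemma symsum_window_closed {R : realType} (F : int -> R[i]) (P N : nat) :
  (P < N)%N ->
  symsum N (fun j => if (- P%:Z <= j) && (j <= P%:Z) then F j else 0) =
  \sum_(k < P.*2.+1) F (k%:Z - P%:Z).
Proof.
move=> PN; rewrite /symsum.
transitivity (\sum_(k < N.*2) (if (N - P <= k < N - P + P.*2.+1)%N
    then F (k%:Z - N%:Z) else 0)).
  by apply: eq_bigr => k _; congr (if _ then _ else _); lia.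
rewrite (sum_window _ (fun k : nat => F (k%:Z - N%:Z))); last lia.
by apply: eq_bigr => k _; congr F; lia.
Qed.

Lemma eq_symsum {R : realType} N (F G : int -> R[i]) :
  (forall j, - N%:Z <= j -> j <= N%:Z - 1 -> F j = G j) -> symsum N F = symsum N G.
Proof. by move=> FG; apply: eq_bigr => k _; apply: FG; have := ltn_ord k; lia. Qed.

Lemma symsum_mull {R : realType} N c (F : int -> R[i]) :
  symsum N (fun j => c * F j) = c * symsum N F.
Proof. by rewrite /symsum mulr_sumr. Qed.

Lemma symsum_shift {R : realType} N (F : int -> R[i]) :
  symsum N (fun j => F (j + 1)) = symsum N F + (F N%:Z - F (- N%:Z)).
Proof.
have -> : F N%:Z - F (- N%:Z) =
    \sum_(k < N.*2) (F (k%:Z - N%:Z + 1) - F (k%:Z - N%:Z)).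
  rewrite -(big_mkord xpredT (fun k => F (k%:Z - N%:Z + 1) - F (k%:Z - N%:Z))).
  rewrite (eq_bigr (fun k : nat => F (k.+1%:Z - N%:Z) - F (k%:Z - N%:Z))).
    by rewrite telescope_sumr//; congr (F _ - F _); lia.
  by move=> k _; congr (F _ - F _); lia.
rewrite /symsum -big_split /=; apply: eq_bigr => k _.
by rewrite addrC subrK.
Qed.

(** * The explicit recurrence, its support and its transform *)

Section Stencil.
Variables (R : realType) (n W : nat) (G : int -> R[i]).
Hypothesis G_supp : forall j, (j < - W%:Z) || (W%:Z <= j) -> G j = 0.

(** The recurrence on all integers, without the end convention of the discrete derivative. The
    coefficient [n] is the time step [1 / n] times the [n ^ 2] of the second difference. *)
Fixpoint stencil (i : nat) : int -> R[i] :=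
  if i is i'.+1 then fun j =>
    stencil i' j + n%:R *
      (stencil i' (j + 2) - stencil i' (j + 1) *+ 2 + stencil i' j)
  else G.

(** Two forward differences look only to the right, so the support spreads left by two cells per
    step and never to the right. *)
Lemma stencil_supp i j :
  (j < - W%:Z - i.*2%:Z) || (W%:Z <= j) -> stencil i j = 0.
Proof.
elim: i j => [|i ih] j jW /=; first by apply: G_supp; lia.
rewrite !ih; [|lia|lia|lia].
by rewrite mul0rn subrr addr0 mulr0 addr0.
Qed.

(** Shifting the function multiplies the sum by [cis c], provided that the terms at both ends
    vanish; [W + 2 i <= N] grants this at every earlier step. *)
Lemma stencil_fourier i N (c : R) : (W + i.*2 <= N)%N ->
  symsum N (fun j => stencil i j * cis (- (c * j%:~R))) =
  multiplier n c ^+ i * symsum N (fun j => G j * cis (- (c * j%:~R))).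
Proof.
elim: i => [|i ih] WN; first by rewrite expr0 mul1r.
rewrite exprS -mulrA -ih; last lia.
have shift1 (F : int -> R[i]) : F N%:Z = 0 -> F (- N%:Z) = 0 ->
    symsum N (fun j => F (j + 1) * cis (- (c * j%:~R))) =
    cis c * symsum N (fun j => F j * cis (- (c * j%:~R))).
  move=> FN FN'.
  have := symsum_shift N (fun j => F j * cis (- (c * j%:~R))).
  rewrite FN FN' !mul0r subrr addr0 => <-; rewrite -symsum_mull.
  apply: eq_symsum => j _ _; rewrite mulrCA -cisD; congr (_ * cis _).
  by rewrite intrD; ring.
have -> : symsum N (fun j => stencil i.+1 j * cis (- (c * j%:~R))) =
    symsum N (fun j => stencil i j * cis (- (c * j%:~R))) +
    n%:R * (symsum N (fun j => stencil i (j + 1 + 1) * cis (- (c * j%:~R)))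
      - symsum N (fun j => stencil i (j + 1) * cis (- (c * j%:~R))) *+ 2
      + symsum N (fun j => stencil i j * cis (- (c * j%:~R)))).
  rewrite /symsum -sumrMnl -sumrB -big_split mulr_sumr -big_split /=.
  by apply: eq_bigr => k _; rewrite -[_ + 1 + 1]addrA; ring.
rewrite (shift1 (fun j => stencil i (j + 1))); last 2 first.
- by apply: stencil_supp; lia.
- by apply: stencil_supp; lia.
rewrite (shift1 (stencil i)); last 2 first.
- by apply: stencil_supp; lia.
- by apply: stencil_supp; lia.
rewrite /multiplier; ring.
Qed.

Definition forward_diff (h : int -> R[i]) (j : int) : R[i] :=
  if j <= (n * n)%:Z - 2 then n%:R * (h (j + 1) - h j) else 0.

(** At the right end the derivative is set to 0, unlike in the stencil, but the support stays away
    and both sides vanish for [j >= n ^ 2 - 2]. At the left end forward differences need no further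
    cell, so the equality persists even after the support has passed that end. *)
Lemma heat_stencil (a : int -> int -> R[i]) : (0 < n)%N ->
  (W + 2 <= n * n)%N ->
  (forall j, - (n * n)%:Z <= j -> j <= (n * n)%:Z - 1 -> a 0 j = G j) ->
  (forall i j, 0 <= i -> i <= (n * n)%:Z - 2 ->
     - (n * n)%:Z <= j -> j <= (n * n)%:Z - 1 ->
     n%:R * (a (i + 1) j - a i j) - forward_diff (forward_diff (a i)) j = 0) ->
  forall (i : nat) j, i%:Z <= (n * n)%:Z - 1 ->
    - (n * n)%:Z <= j -> j <= (n * n)%:Z - 1 -> a i%:Z j = stencil i j.
Proof.
move=> n0 WN a0 aS; elim=> [|i ih] j iN jN Nj; first exact: a0.
have nC : n%:R != 0 :> R[i] by rewrite pnatr_eq0 -lt0n.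
have aS1 : n%:R * (a i.+1%:Z j - a i%:Z j) =
    forward_diff (forward_diff (a i%:Z)) j.
  apply/eqP; rewrite -subr_eq0 (_ : i.+1%:Z = i%:Z + 1); last lia.
  by apply/eqP/aS; lia.
have -> : a i.+1%:Z j = a i%:Z j +
    n%:R^-1 * forward_diff (forward_diff (a i%:Z)) j.
  by rewrite -aS1 mulKf// addrC subrK.
have hi l : - (n * n)%:Z <= l -> l <= (n * n)%:Z - 1 -> a i%:Z l = stencil i l.
  by move=> *; apply: ih; lia.
rewrite [stencil i.+1 j]/= hi//; congr (_ + _).
(* Up to [n ^ 2 - 3] both nested differences are in their regular branch. *)
have [j3|j3] := leP j ((n * n)%:Z - 3).
  rewrite /forward_diff !ifT; [|lia|lia|lia].
  rewrite !hi; [|lia|lia|lia|lia|lia|lia].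
  rewrite -[_ + 1 + 1]addrA mulKf//; ring.
have st0 l : (n * n)%:Z - 2 <= l -> stencil i l = 0.
  by move=> *; apply: stencil_supp; lia.
rewrite !st0; [|lia|lia|lia].
rewrite mul0rn subrr addr0 mulr0 {1}/forward_diff.
have [j2|j2] := leP j ((n * n)%:Z - 2); last by rewrite mulr0.
rewrite /forward_diff ifF; last lia.
rewrite ifT// !hi; [|lia|lia|lia|lia].
by rewrite !st0; [|lia|lia]; rewrite subrr mulr0 subrr !mulr0.
Qed.
End Stencil.

(** * The discrete heat kernel and its Gaussian approximation *)

Section Kernel.
Variables (R : realType) (n P i : nat).
Hypothesis n0 : (0 < n)%N.
Let nR : 0 < n%:R :> R. Proof. by rewrite ltr0n. Qed.
(** The discrete fundamental solution after [i] steps, restricted to the frequencies up to [P];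
    [2^-1] is the value of the cutoff. *)
Definition heat_kernel (u : R) : R[i] :=
  \sum_(k < (P * n).*2.+1) n%:R^-1 *
    (2^-1 * multiplier n (pi * (k%:Z - (P * n)%:Z)%:~R / n%:R / n%:R) ^+ i *
     cis (pi * ((k%:Z - (P * n)%:Z)%:~R / n%:R) * u)).

(** An interchange of finite sums: the two characters combine into one at [x - j / n], which leaves
    a discrete convolution. The windows first remove the zero terms of both sums. *)
Lemma inv_fourier_sum (w : nat) (f : R -> R[i]) (x : R) :
  (P < n)%N -> (w <= n)%N ->
  n%:R^-1 * symsum (n * n) (fun k =>
    (if (- (P * n)%:Z <= k) && (k <= (P * n)%:Z) then 2^-1 else 0) *
    (n%:R^-1 * (multiplier n (pi * k%:~R / n%:R / n%:R) ^+ i *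
      symsum (n * n) (fun j =>
        (if (- (w * n)%:Z <= j) && (j < (w * n)%:Z) then f (j%:~R / n%:R) else 0)
        * cis (- (pi * k%:~R / n%:R / n%:R * j%:~R))))) *
    cis (pi * (k%:~R / n%:R) * x)) =
  symsum (w * n) (fun j =>
    n%:R^-1 * f (j%:~R / n%:R) * heat_kernel (x - j%:~R / n%:R)).
Proof.
move=> Pn wn.
have nC : n%:R != 0 :> R[i] by rewrite pnatr_eq0 -lt0n.
transitivity (n%:R^-1 * symsum (n * n) (fun k =>
    (if (- (P * n)%:Z <= k) && (k <= (P * n)%:Z) then
    2^-1 * (n%:R^-1 * (multiplier n (pi * k%:~R / n%:R / n%:R) ^+ i *
      symsum (w * n) (fun j => f (j%:~R / n%:R)
        * cis (- (pi * k%:~R / n%:R / n%:R * j%:~R))))) *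
    cis (pi * (k%:~R / n%:R) * x) else 0))).
  congr (_ * _); apply: eq_symsum => k _ _.
  case: ifP => _; last by rewrite !mul0r.
  congr (_ * (_ * (_ * _)) * _).
  rewrite -(@symsum_window _ _ (w * n) (n * n)); last by rewrite leq_mul2r wn orbT.
  by apply: eq_symsum => j _ _; case: ifP => _; rewrite ?mul0r.
rewrite symsum_window_closed; last by rewrite ltn_mul2r n0.
rewrite [RHS](eq_bigr (fun j : 'I_((w * n).*2) =>
  \sum_(k < (P * n).*2.+1)
    n%:R^-1 * f ((j%:Z - (w * n)%:Z)%:~R / n%:R) * (n%:R^-1 *
    (2^-1 * multiplier n (pi * (k%:Z - (P * n)%:Z)%:~R / n%:R / n%:R) ^+ i *
     cis (pi * ((k%:Z - (P * n)%:Z)%:~R / n%:R) *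
       (x - (j%:Z - (w * n)%:Z)%:~R / n%:R))))));
  last by move=> j _; rewrite /heat_kernel mulr_sumr.
rewrite exchange_big /= mulr_sumr; apply: eq_bigr => k _.
rewrite /symsum !(mulr_sumr, mulr_suml); apply: eq_bigr => j _.
set kk := (_ - _)%:~R; set jj := (_ - _)%:~R.
have -> : pi * (kk / n%:R) * (x - jj / n%:R) =
   pi * (kk / n%:R) * x + - (pi * kk / n%:R / n%:R * jj).
  by field; rewrite gt_eqF.
rewrite cisD; ring.
Qed.

(** Reversing the order of summation shows that the sine part equals its opposite. The parameters
    come from [i n (pi k / n ^ 2) ^ 2 = pi ^ 2 (i / n) (k / n) ^ 2]. *)
Lemma gauss_sumE (u : R) :
  ((gauss_sum (pi ^+ 2 * (i%:R / n%:R)) n%:R^-1 (pi * u) (P * n))%:C)%C =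
  \sum_(k < (P * n).*2.+1) n%:R^-1 *
    (((expR (- (n%:R * (pi * (k%:Z - (P * n)%:Z)%:~R / n%:R / n%:R) ^+ 2)))%:C)%C
       ^+ i * cis (pi * ((k%:Z - (P * n)%:Z)%:~R / n%:R) * u)).
Proof.
pose c (k : nat) : R := n%:R^-1 * expR (- (n%:R *
  (pi * (k%:Z - (P * n)%:Z)%:~R / n%:R / n%:R) ^+ 2)) ^+ i.
pose b (k : nat) : R := pi * ((k%:Z - (P * n)%:Z)%:~R / n%:R) * u.
transitivity (\sum_(k < (P * n).*2.+1) ((c k * cos (b k)) +i* (c k * sin (b k)))%C).
  have im0 : \sum_(k < (P * n).*2.+1) c k * sin (b k) = 0.
    have : \sum_(k < (P * n).*2.+1) c k * sin (b k) =
        - \sum_(k < (P * n).*2.+1) c k * sin (b k).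
      rewrite {1}(reindex_inj rev_ord_inj) -sumrN; apply: eq_bigr => k _ /=.
      have kP : ((P * n).*2.+1 - k.+1)%N%:Z - (P * n)%:Z = - (k%:Z - (P * n)%:Z).
        by have := ltn_ord k; lia.
      rewrite /c /b kP rmorphN /= !(mulrN, mulNr) sqrrN sinN mulrN.
      by [].
    by move=> /eqP; rewrite -subr_eq0 opprK -mulr2n mulrn_eq0/= => /eqP.
  apply/eqP; rewrite eq_complex; apply/andP; split; apply/eqP; last first.
    by rewrite /= raddf_sum /= im0.
  rewrite /= raddf_sum /=.
  rewrite /gauss_sum; apply: eq_bigr => k _; rewrite /c /b -expRM_natl.
  rewrite intrB -!pmulrn; congr (_ * expR _ * cos _); field.
    by rewrite gt_eqF.
  by rewrite gt_eqF.
apply: eq_bigr => k _; rewrite -rmorphXn /= mulrA.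
rewrite (_ : n%:R^-1 = ((n%:R^-1 : R)%:C)%C); last by rewrite fmorphV rmorph_nat.
rewrite -rmorphM /= -/(c k) -/(b k).
by apply/eqP; rewrite eq_complex /= !mul0r subr0 addr0 !eqxx.
Qed.

Lemma heat_kernel_gauss (u T X : R) : (0 < P)%N -> 0 <= T ->
  i%:R <= T * n%:R ->
  X = T * (6 * pi ^+ 3 + pi ^+ 4) * P%:R ^+ 4 / n%:R ->
  normc (heat_kernel u -
    ((2^-1 * gauss_sum (pi ^+ 2 * (i%:R / n%:R)) n%:R^-1 (pi * u) (P * n))%:C)%C)
  <= (P * n).*2.+1%:R / n%:R * (2^-1 * (X * expR X)).
Proof.
move=> P0 T0 iT XE.
have half : (2^-1 : R[i]) = ((2^-1 : R)%:C)%C by rewrite fmorphV rmorph_nat.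
have ninv : (n%:R^-1 : R[i]) = ((n%:R^-1 : R)%:C)%C by rewrite fmorphV rmorph_nat.
set S := gauss_sum _ _ _ _.
have -> : ((2^-1 * S)%:C)%C = 2^-1 * (S%:C)%C by rewrite half -rmorphM.
rewrite {}/S gauss_sumE mulr_sumr /heat_kernel -sumrB.
apply: le_trans (normc_sum _ _ _ _) _.
rewrite -mulrA mulr_natl -[X in _ <= _ *+ X](card_ord (P * n).*2.+1) -sumr_const.
apply: ler_sum => k _; set th := pi * _ / _ / _; set E := cis _.
rewrite [X in normc X](_ : _ = n%:R^-1 * (2^-1 *
  ((multiplier n th ^+ i - ((expR (- (n%:R * th ^+ 2)))%:C)%C ^+ i) * E)));
  last by ring.
rewrite !normcM normc_cis mulr1 half ninv !normc_real.
rewrite !ger0_norm ?invr_ge0 ?(ltW nR)// ler_pM2l ?invr_gt0// ler_pM2l//.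
apply: (@multiplier_pow_bound _ _ _ _ P%:R T) => //; first by rewrite ler1n.
rewrite /th !normrM normfV (gtr0_norm nR) (ger0_norm (pi_ge0 R)).
rewrite ler_pM2r ?invr_gt0// -mulrA ler_wpM2l ?pi_ge0// ler_pdivrMr//.
have kP : (k <= (P * n).*2)%N by rewrite -ltnS.
rewrite -natrM -intr_norm (pmulrn _ (P * n)) ler_int; lia.
Qed.

Lemma heat_kernel_approx (u T X a : R) : (0 < P)%N -> (0 < i)%N -> 0 <= T ->
  i%:R <= T * n%:R ->
  X = T * (6 * pi ^+ 3 + pi ^+ 4) * P%:R ^+ 4 / n%:R ->
  a = pi ^+ 2 * (i%:R / n%:R) ->
  normc (heat_kernel u - ((2^-1 * (expR (- ((4 * (i%:R / n%:R))^-1 * u ^+ 2)) *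
    gauss_sum a n%:R^-1 0 (P * n)))%:C)%C)
  <= (P * n).*2.+1%:R / n%:R * (2^-1 * (X * expR X)) +
    2^-1 * (`|pi * u| * ((2 * a)^-1 *
    (2 * expR (- (a * P%:R ^+ 2)) + (P * n).*2.+1%:R * (n%:R^-1 ^+ 2 *
    ((2 * a * ((P * n).+1%:R * n%:R^-1) + `|pi * u|) ^+ 2 + 2 * a))))).
Proof.
move=> P0 i0 T0 iT XE aE.
have a0 : 0 < a by rewrite aE mulr_gt0 ?exprn_gt0 ?pi_gt0// divr_gt0// ltr0n.
have nV0 : 0 < n%:R^-1 :> R by rewrite invr_gt0.
have := heat_kernel_gauss u T X P0 T0 iT XE.
have := @gauss_sum_le _ a n%:R^-1 (P * n) a0 nV0 (pi * u).
rewrite -aE natrM mulfK ?gt_eqF//.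
(* The factors [pi ^ 2] cancel, which leaves the exponent of the heat kernel at time [i / n]. *)
have -> : (pi * u) ^+ 2 / (4 * a) = (4 * (i%:R / n%:R))^-1 * u ^+ 2.
  have pi0 : pi != 0 :> R by rewrite gt_eqF ?pi_gt0.
  have inz : i%:R != 0 :> R by rewrite pnatr_eq0 -lt0n.
  have nnz : n%:R != 0 :> R by rewrite pnatr_eq0 -lt0n.
  rewrite aE; move: (pi : R) pi0 => p p0.
  by field; rewrite p0 inz nnz.
set S := gauss_sum _ _ _ _; set S0 := gauss_sum _ _ _ _ => h1 h2.
rewrite -[heat_kernel u](subrK ((2^-1 * S)%:C)%C) -addrA.
apply: le_trans (le_normcD _ _) _; apply: lerD => //.
rewrite -rmorphB normc_real -mulrBr normrM ger0_norm//.
by rewrite ler_pM2l.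
Qed.
End Kernel.
Arguments heat_kernel {R} n P i u.

(** * The limit of the discrete solutions *)

(** [|u|] must be allowed up to [x1 + P] because the window reaches [w <= P]. The power 5 is [P ^ 4]
    from the multiplier times the total weight [3 P] of the frequencies; [expR (- P ^ 2)] bounds
    [1 / n], and the other exponential is the Gaussian at the cutoff for the smallest time. *)
Lemma heat_kernel_error {R : realType} (t1 T x1 : R) : 0 < t1 -> t1 <= T ->
  0 <= x1 -> exists2 K : R, 0 <= K & forall (n P i : nat) (u : R),
    (0 < n)%N -> (0 < P)%N -> (0 < i)%N -> t1 <= i%:R / n%:R <= T ->
    `|u| <= x1 + P%:R -> expR (P%:R ^+ 2) <= n%:R :> R ->
    normc (heat_kernel n P i u -
      ((2^-1 * (expR (- ((4 * (i%:R / n%:R))^-1 * u ^+ 2)) *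
        gauss_sum ((pi : R) ^+ 2 * (i%:R / n%:R)) n%:R^-1 0 (P * n)))%:C)%C) <=
    K * P%:R ^+ 5 * (expR (- (P%:R ^+ 2)) + expR (- ((pi : R) ^+ 2 * t1 * P%:R ^+ 2))).
Proof.
move=> t10 t1T x10; have T0 : 0 < T by apply: lt_le_trans t1T.
have pi0 := pi_gt0 R.
pose C1 : R := 6 * pi ^+ 3 + pi ^+ 4.
have C10 : 0 <= C1 by rewrite addr_ge0 ?mulr_ge0 ?exprn_ge0// ltW.
pose a1 := pi ^+ 2 * t1; have a10 : 0 < a1 by rewrite mulr_gt0 ?exprn_gt0.
pose a2 := pi ^+ 2 * T; have a20 : 0 < a2 by rewrite mulr_gt0 ?exprn_gt0.
(* [Y * P] will bound [|pi * u|], and [D * P ^ 2] the second-derivative factor of [gauss_sum_le].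
   [K1] collects the error of the multiplier, [K2] that of the Gaussian sum: 2 for the end values,
   [3 * D] for the Taylor remainder. *)
pose Y := pi * (x1 + 1); have Y0 : 0 <= Y by apply: mulr_ge0; [exact: ltW|exact: addr_ge0].
pose D := (4 * a2 + Y) ^+ 2 + 2 * a2.
have D0 : 0 <= D by rewrite addr_ge0 ?sqr_ge0// mulr_ge0// ltW.
pose K1 := 3 / 2 * (T * C1) * expR (2 * (T * C1)).
have TC0 : 0 <= T * C1 by rewrite mulr_ge0// ltW.
have K10 : 0 <= K1 by rewrite /K1 mulr_ge0 ?expR_ge0// mulr_ge0// divr_ge0.
pose K2 := 2^-1 * (Y * ((2 * a1)^-1 * (2 + 3 * D))).
have K20 : 0 <= K2.
  have ? : 0 <= (2 * a1)^-1 by rewrite invr_ge0 mulr_ge0// ltW.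
  have ? : 0 <= 2 + 3 * D by rewrite addr_ge0// mulr_ge0.
  by rewrite /K2 mulr_ge0// mulr_ge0// mulr_ge0.
exists (K1 + K2); first exact: addr_ge0.
move=> n P i u n0 P0 i0 /andP[ti iT] uP Pn.
have nR : 0 < n%:R :> R by rewrite ltr0n.
have nV0 : 0 <= n%:R^-1 :> R by rewrite invr_ge0 ltW.
have nV1 : n%:R^-1 <= 1 :> R by rewrite invf_le1// ler1n.
have p1 : 1 <= P%:R :> R by rewrite ler1n.
have MP : (P * n).*2.+1%:R / n%:R <= 3 * P%:R :> R.
  rewrite -natr1 -muln2 !natrM mulrDl mul1r mulrAC mulfK ?gt_eqF//; lra.
have M2P : (P * n).+1%:R / n%:R <= 2 * P%:R :> R.
  rewrite -natr1 natrM mulrDl mul1r mulfK ?gt_eqF//; lra.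
move: (expR_ge0 (- (P%:R ^+ 2 : R))) (expR_ge0 (- (a1 * P%:R ^+ 2))).
have nq : n%:R^-1 <= expR (- (P%:R ^+ 2)) :> R.
  by rewrite expRN lef_pV2 ?posrE ?expR_gt0.
(* From [1 + s ^ 2 / 2 <= expR s] at [s = P ^ 2]. It bounds [X] by a constant, so that [expR X] can
   go into [K1]. *)
have p4q : P%:R ^+ 4 * expR (- P%:R ^+ 2) <= 2 :> R.
  rewrite expRN ler_pdivrMr ?expR_gt0//.
  have := @expR_ge1Dxn R (P%:R ^+ 2) 1 (sqr_ge0 _).
  rewrite -exprM (_ : 2`!%:R = 2)// => h; lra.
have p40 : 0 <= T * C1 * P%:R ^+ 4 by apply: mulr_ge0 => //; exact: exprn_ge0.
set X : R := T * C1 * P%:R ^+ 4 / n%:R.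
have X0 : 0 <= X by exact: mulr_ge0.
have Xq : X <= T * C1 * P%:R ^+ 4 * expR (- P%:R ^+ 2) by rewrite ler_wpM2l.
have X2 : X <= 2 * (T * C1).
  by apply: le_trans Xq _; rewrite -mulrA mulrC ler_wpM2r.
have iTn : i%:R <= T * n%:R by rewrite -ler_pdivrMr.
have := @heat_kernel_approx _ n P i n0 u T X _ P0 i0 (ltW T0) iTn erefl erefl.
set a := pi ^+ 2 * (i%:R / n%:R).
have a1a : a1 <= a by rewrite ler_pM2l// exprn_gt0.
have aa2 : a <= a2 by rewrite ler_pM2l// exprn_gt0.
have a0 : 0 < a by apply: lt_le_trans a1a.
have rr : expR (- (a * P%:R ^+ 2)) <= expR (- (a1 * P%:R ^+ 2)).
  by rewrite ler_expR lerN2 ler_wpM2r// exprn_ge0.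
have uY : `|pi * u| <= Y * P%:R.
  rewrite normrM (gtr0_norm pi0) /Y -mulrA ler_pM2l//.
  by apply: le_trans uP _; rewrite mulrDl mul1r lerD2r ler_peMr.
move=> h q0 r0; apply: le_trans h _.
set q := expR (- (P%:R ^+ 2)) in q0 nq p4q Xq *.
set r := expR (- (a1 * P%:R ^+ 2)) in r0 rr *.
rewrite -/a1 -/r -(mulrA (K1 + K2)) [leRHS]mulrDl; apply: lerD.
  apply: (@le_trans _ _ (K1 * (P%:R ^+ 5 * q))).
    apply: (@le_trans _ _ (3 * P%:R *
        (2^-1 * (T * C1 * P%:R ^+ 4 * q * expR (2 * (T * C1)))))).
      have XX : 0 <= X * expR X by rewrite mulr_ge0// expR_ge0.
      have MM : 0 <= (P * n).*2.+1%:R / n%:R :> R by exact: mulr_ge0.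
      apply: ler_pM => //; first exact: mulr_ge0.
      by rewrite ler_wpM2l// ler_pM ?expR_ge0// ler_expR.
    by rewrite le_eqVlt; apply/orP; left; apply/eqP; rewrite /K1; field.
  by rewrite ler_wpM2l// ler_wpM2l ?exprn_ge0// lerDl.
have -> : K2 * (P%:R ^+ 5 * (q + r)) = 2^-1 *
  (Y * P%:R * ((2 * a1)^-1 * ((2 + 3 * D) * (P%:R ^+ 4 * (q + r))))).
  by rewrite /K2; ring.
rewrite ler_pM2l//.
have inner0 : 0 <= (P * n).*2.+1%:R * (n%:R^-1 ^+ 2 *
  ((2 * a * ((P * n).+1%:R / n%:R) + `|pi * u|) ^+ 2 + 2 * a)).
  rewrite mulr_ge0// mulr_ge0 ?sqr_ge0// addr_ge0 ?sqr_ge0// mulr_ge0//.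
  exact: ltW.
have a2V : 0 <= (2 * a)^-1 by rewrite invr_ge0 mulr_ge0// ltW.
have in0 : 0 <= 2 * expR (- (a * P%:R ^+ 2)) + (P * n).*2.+1%:R * (n%:R^-1 ^+ 2 *
  ((2 * a * ((P * n).+1%:R / n%:R) + `|pi * u|) ^+ 2 + 2 * a)).
  by apply: addr_ge0 => //; apply: mulr_ge0 => //; exact: expR_ge0.
apply: ler_pM => //; first exact: mulr_ge0.
apply: ler_pM => //.
  have d1 : 0 < 2 * a1 by exact: mulr_gt0.
  have d2 : 0 < 2 * a by exact: mulr_gt0.
  by rewrite lef_pV2 ?posrE// ler_pM2l.
have p40' : 1 <= P%:R ^+ 4 :> R by rewrite exprn_ege1.
have h1 : 2 * expR (- (a * P%:R ^+ 2)) <= 2 * (P%:R ^+ 4 * (q + r)).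
  rewrite ler_pM2l//; apply: le_trans rr _.
  apply: (@le_trans _ _ (q + r)); first by rewrite lerDr.
  by rewrite ler_peMl// addr_ge0.
have h2 : (2 * a * ((P * n).+1%:R / n%:R) + `|pi * u|) ^+ 2 + 2 * a <=
    D * P%:R ^+ 2.
  have -> : D * P%:R ^+ 2 = (4 * a2 * P%:R + Y * P%:R) ^+ 2 +
    2 * a2 * P%:R ^+ 2 by rewrite /D; ring.
  apply: lerD.
    have q1 : 2 * a * ((P * n).+1%:R / n%:R) <= 4 * a2 * P%:R.
      have -> : 4 * a2 * P%:R = 2 * a2 * (2 * P%:R) by ring.
      have a20' : 0 <= 2 * a by apply: mulr_ge0 => //; exact: ltW.
      have Pn0 : 0 <= (P * n).+1%:R / n%:R :> R by exact: mulr_ge0.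
      by apply: ler_pM => //; rewrite ler_pM2l.
    have q2 : 0 <= 2 * a * ((P * n).+1%:R / n%:R).
      by apply: mulr_ge0; [apply: mulr_ge0 => //; exact: ltW|exact: mulr_ge0].
    have q3 : 0 <= 2 * a * ((P * n).+1%:R / n%:R) + `|pi * u| by exact: addr_ge0.
    have q4 : 2 * a * ((P * n).+1%:R / n%:R) + `|pi * u| <=
      4 * a2 * P%:R + Y * P%:R by exact: lerD.
    by apply: lerXn2r; rewrite ?nnegrE// (le_trans q3 q4).
  apply: (@le_trans _ _ (2 * a2)); first by rewrite ler_pM2l.
  by apply: ler_peMr; [apply: mulr_ge0 => //; exact: ltW|exact: exprn_ege1].
have h3 : (P * n).*2.+1%:R * (n%:R^-1 ^+ 2 *
    ((2 * a * ((P * n).+1%:R / n%:R) + `|pi * u|) ^+ 2 + 2 * a)) <=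
    3 * D * (P%:R ^+ 4 * (q + r)).
  have -> (z : R) : (P * n).*2.+1%:R * (n%:R^-1 ^+ 2 * z) =
      (P * n).*2.+1%:R / n%:R * (n%:R^-1 * z) by ring.
  apply: (@le_trans _ _ (3 * P%:R * (q * (D * P%:R ^+ 2)))).
    have sq0 : 0 <= (2 * a * ((P * n).+1%:R / n%:R) + `|pi * u|) ^+ 2 + 2 * a.
      by apply: addr_ge0; [exact: sqr_ge0|apply: mulr_ge0 => //; exact: ltW].
    have Pn0 : 0 <= (P * n).*2.+1%:R / n%:R :> R by exact: mulr_ge0.
    have nsq0 := mulr_ge0 nV0 sq0.
    by apply: ler_pM => //; apply: ler_pM.
  have -> : 3 * P%:R * (q * (D * P%:R ^+ 2)) = 3 * D * (P%:R ^+ 3 * q) by ring.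
  apply: ler_wpM2l; first exact: mulr_ge0.
  have P3 : P%:R ^+ 3 <= P%:R ^+ 4 :> R by exact: ler_weXn2l.
  have P30 : 0 <= P%:R ^+ 3 :> R by exact: exprn_ge0.
  have qr : q <= q + r by rewrite lerDl.
  exact: ler_pM.
by rewrite [(2 + 3 * D) * _]mulrDl; apply: lerD.
Qed.

(** [P ^ 6 <= 6! expR P], and [c P ^ 2 >= 3 P] once [P >= 3 / c]: the product is at most
    [720 K expR (- P)]. *)
Lemma poly_exp_gauss_lim {R : realType} (c K e : R) : 0 < c -> 0 <= K -> 0 < e ->
  exists M : nat, forall P : nat, (M <= P)%N ->
    K * P%:R ^+ 6 * expR P%:R * expR (- (c * P%:R ^+ 2)) < e.
Proof.
move=> c0 K0 e0.
exists (Num.trunc (3 / c) + Num.trunc (720 * K / e)).+2 => P MP.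
have n_ge (z : R) : (Num.trunc z < P)%N -> z < P%:R.
  move=> zP; apply: lt_le_trans (truncnS_gt z) _.
  by rewrite ler_nat.
have P1 : 3 / c < P%:R by apply: n_ge; lia.
have P2 : 720 * K / e < P%:R by apply: n_ge; lia.
have p0 : 0 < P%:R :> R by rewrite ltr0n; lia.
set p : R := P%:R in P1 P2 p0 *.
have p6 : p ^+ 6 <= 720 * expR p.
  have := @expR_ge1Dxn R p 5 (ltW p0).
  by rewrite (_ : 6`!%:R = 720)// => h; lra.
have cp : 3 * p <= c * p ^+ 2.
  by rewrite expr2 mulrA ler_wpM2r ?(ltW p0)// mulrC -ler_pdivrMr// ltW.
apply: (@le_lt_trans _ _ (K * (720 * expR p) * expR p * expR (- (3 * p)))).
  rewrite ler_pM ?mulr_ge0 ?expR_ge0 ?exprn_ge0 ?(ltW p0)//.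
    rewrite ler_wpM2r ?expR_ge0// ler_wpM2l//.
  by rewrite ler_expR lerN2.
have -> : K * (720 * expR p) * expR p * expR (- (3 * p)) =
    720 * K * (expR p * expR p * expR (- (3 * p))) by ring.
rewrite -!expRD (_ : p + p + - (3 * p) = - p); last by ring.
rewrite expRN ltr_pdivrMr ?expR_gt0//.
rewrite ltr_pdivrMr// in P2; apply: lt_le_trans P2 _.
rewrite [leRHS]mulrC ler_pM2r//; have := expR_ge1Dx p; lra.
Qed.

Lemma mul_close {R : realFieldType} (s r e : R) : 0 < e ->
  exists2 d : R, 0 < d &
    forall S Q, `|S - s| < d -> `|Q - r| < d -> `|S * Q - s * r| < e.
Proof.
move=> e0; pose D := `|s| + `|r| + 2.
have D0 : 0 < D by rewrite ltr_wpDl// addr_ge0.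
exists (Num.min 1 (e / D)); first by rewrite lt_min ltr01 divr_gt0.
move=> S Q; rewrite !lt_min => /andP[S1 Se] /andP[Q1 Qe].
have -> : S * Q - s * r = (S - s) * Q + s * (Q - r) by ring.
apply: le_lt_trans (ler_normD _ _) _; rewrite !normrM.
have QB : `|Q| <= `|r| + 1.
  rewrite -[Q](subrK r); apply: le_trans (ler_normD _ _) _.
  by rewrite addrC lerD2l ltW.
have eE : e = e / D * (`|r| + 1) + `|s| * (e / D) + e / D.
  rewrite [_ + _ + e / D](_ : _ = e / D * D); last by rewrite /D; ring.
  by rewrite divfK ?gt_eqF.
have h1 : `|S - s| * `|Q| <= e / D * (`|r| + 1) by rewrite ler_pM// ltW.
have h2 : `|s| * `|Q - r| <= `|s| * (e / D) by rewrite ler_wpM2l// ltW.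
have eD : 0 < e / D by rewrite divr_gt0.
by rewrite [X in _ < X]eE; lra.
Qed.

Lemma natr_gt {R : realType} (z : R) n : (Num.trunc z < n)%N -> z < n%:R.
Proof.
by move=> zn; apply: lt_le_trans (truncnS_gt z) _; rewrite ler_nat.
Qed.

Lemma inv_close {R : realFieldType} (t0 d : R) : 0 < t0 -> 0 < d ->
  exists2 d' : R, 0 < d' &
    forall t, `|t - t0| < d' -> `|(4 * t)^-1 - (4 * t0)^-1| < d.
Proof.
move=> t00 d0; have t02 : 0 < 2 * t0 ^+ 2 by rewrite mulr_gt0// exprn_gt0.
exists (Num.min (t0 / 2) (d * (2 * t0 ^+ 2))).
  by rewrite lt_min divr_gt0//= mulr_gt0.
move=> t; rewrite !lt_min => /andP[h1 h2].
have t1 : t0 / 2 < t by move: h1; rewrite ltr_norml => /andP[? ?]; lra.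
have tpos : 0 < t by lra.
have q : 2 * t0 ^+ 2 < 4 * t * t0 by rewrite expr2 mulrA ltr_pM2r//; lra.
have q0 : 0 < 4 * t * t0 by apply: lt_trans q.
have -> : (4 * t)^-1 - (4 * t0)^-1 = - (t - t0) / (4 * t * t0).
  by field; rewrite !gt_eqF.
rewrite normrM normfV (gtr0_norm q0) normrN ltr_pdivrMr//.
by apply: lt_trans h2 _; rewrite ltr_pM2l.
Qed.

(** The Gaussian integral is [sqrt (pi / (pi ^ 2 t0)) = 2 / sqrt (4 pi t0)]; its 2 will meet the
    [1/2] of the cutoff. *)
Lemma gauss_sum_lim {R : realType} (t0 e : R) : 0 < t0 -> 0 < e ->
  exists (M : nat) (d : R), 0 < d /\ forall (n P : nat) (t : R),
    (M <= n)%N -> (M <= P)%N -> `|t - t0| < d ->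
    `|gauss_sum (pi ^+ 2 * t) n%:R^-1 0 (P * n) - 2 * (Num.sqrt (4 * pi * t0))^-1|
      < e.
Proof.
move=> t00 e0; have pi0 := pi_gt0 R.
have pi20 : 0 < (pi : R) ^+ 2 by rewrite exprn_gt0.
have a0 : 0 < pi ^+ 2 * t0 by rewrite mulr_gt0.
have growth1 : forall e : R, 0 < e -> exists C : R, forall x : R,
    `|(fun=> 1) x : R| <= C * expR (e * x ^+ 2).
  move=> d d0; exists 1 => x; rewrite normr1 mul1r -expR0 ler_expR.
  by rewrite mulr_ge0 ?sqr_ge0 ?ltW.
have e2 : 0 < e / 2 by rewrite divr_gt0.
have [M [d [d0 Md]]] := @riemann_sum_lim R (fun=> 1) (fun x => cvg_cst _) growth1
  (pi ^+ 2 * t0) 0 (e / 2) a0 e2.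
exists (maxn M (Num.trunc (2 / e)).+1), (Num.min (d / pi ^+ 2) t0).
split; first by rewrite lt_min t00 andbT divr_gt0.
move=> n P t; rewrite !geq_max lt_min => /andP[Mn en] /andP[MP _] /andP[tt tt0].
have tpos : 0 < t by move: tt0; rewrite ltr_norml => /andP[? ?]; lra.
have n_gt := natr_gt _ _ en.
have n0 : 0 < n%:R :> R by apply: lt_trans n_gt; rewrite divr_gt0.
have ne2 : n%:R^-1 < e / 2.
  by rewrite -[e / 2]invrK ltf_pV2 ?posrE ?invr_gt0// invf_div.
have := Md n P 0 (pi ^+ 2 * t) Mn MP.
rewrite subrr normr0 -mulrBr normrM (gtr0_norm pi20) => /(_ d0).
rewrite mulrC -ltr_pdivlMr// => /(_ tt).
have -> : \int[lebesgue_measure]_z (1 * expR (- (pi ^+ 2 * t0 * (0 - z) ^+ 2)))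
   = 2 * (Num.sqrt (4 * pi * t0))^-1 :> R.
  transitivity (\int[@lebesgue_measure R]_z expR (- (pi ^+ 2 * t0 * z ^+ 2))).
    by apply: eq_Rintegral => z _; rewrite mul1r sub0r sqrrN.
  rewrite integral_gauss//.
  have -> : pi / (pi ^+ 2 * t0) = 2 ^+ 2 * (4 * pi * t0)^-1 :> R.
    move: (pi : R) pi0 => p p0; by field; rewrite !gt_eqF.
  rewrite sqrtrM ?sqr_ge0// sqrtr_sqr sqrtrV ?ger0_norm//.
  by rewrite mulr_ge0 ?(ltW t00)// mulr_ge0 ?ltW.
set I := 2 * _; set S := riemann_sum _ _ _ _ => SI.
(* The cutoff is closed at both ends while [riemann_sum] omits the right one; the extra node
   contributes at most [1 / n]. *)
have -> : gauss_sum (pi ^+ 2 * t) n%:R^-1 0 (P * n) =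
    S + n%:R^-1 * expR (- (pi ^+ 2 * t * P%:R ^+ 2)).
  rewrite /gauss_sum big_ord_recr /=; congr (_ + _).
    apply: eq_bigr => k _; rewrite mul0r cos0 mulr1 mul1r sub0r sqrrN.
    by rewrite intrB -!pmulrn.
  rewrite mul0r cos0 mulr1 -addnn natrD addrK natrM mulfK ?gt_eqF//.
rewrite addrAC; apply: le_lt_trans (ler_normD _ _) _.
rewrite [e]splitr; apply: ltrD => //.
rewrite ger0_norm ?mulr_ge0 ?expR_ge0 ?invr_ge0 ?(ltW n0)//.
apply: le_lt_trans ne2; rewrite ler_piMr ?invr_ge0 ?(ltW n0)//.
by rewrite expR_le1 oppr_le0 mulr_ge0 ?sqr_ge0// ltW// mulr_gt0.
Qed.

Lemma main_term_lim {R : realType} (f : R -> R) (t0 x0 e : R) :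
  continuous f ->
  (forall e : R, 0 < e -> exists C : R, forall x, `|f x| <= C * expR (e * x ^+ 2)) ->
  0 < t0 -> 0 < e ->
  exists (M : nat) (d : R), 0 < d /\ forall (n w P : nat) (t x : R),
    (M <= n)%N -> (M <= w)%N -> (M <= P)%N -> `|t - t0| < d -> `|x - x0| < d ->
    `|2^-1 * gauss_sum (pi ^+ 2 * t) n%:R^-1 0 (P * n) *
      riemann_sum R n w (fun z => f z * expR (- ((4 * t)^-1 * (x - z) ^+ 2))) -
      (Num.sqrt (4 * pi * t0))^-1 *
      \int[lebesgue_measure]_z (expR (- (x0 - z) ^+ 2 / (4 * t0)) * f z)| < e.
Proof.
move=> f_cont f_growth t00 e0.
have a0 : 0 < (4 * t0)^-1 by rewrite invr_gt0 mulr_gt0.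
set s := (Num.sqrt _)^-1.
set I := \int[_]_ _ _.
have [d1 d10 sI] := mul_close s I e e0.
have d12 : 0 < 2 * d1 by rewrite mulr_gt0.
have [M1 [d2 [d20 G]]] := gauss_sum_lim t0 (2 * d1) t00 d12.
have [M2 [d3 [d30 Q]]] := riemann_sum_lim R f f_cont f_growth _ x0 d1 a0 d10.
have [d4 d40 inv] := inv_close t0 d3 t00 d30.
exists (maxn M1 M2), (Num.min d2 (Num.min d3 d4)).
split; first by rewrite !lt_min d20 d30.
move=> n w P t x; rewrite !geq_max !lt_min.
move=> /andP[n1 n2] /andP[w1 w2] /andP[P1 P2] /andP[tt1 /andP[_ tt2]].
move=> /andP[_ /andP[xx _]].
have Is : \int[lebesgue_measure]_z (f z * expR (- ((4 * t0)^-1 * (x0 - z) ^+ 2)))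
    = I.
  apply: eq_Rintegral => z _; rewrite mulrC; congr (expR _ * _).
  by rewrite mulNr mulrC.
apply: sI; last by rewrite -Is; apply: Q => //; exact: inv.
rewrite -(@ltr_pM2l _ 2)// -[X in X * `|_|](@gtr0_norm _ 2)// -normrM mulrBr.
by rewrite mulVKf//; exact: G.
Qed.

Lemma Re_mul_real {R : realType} (r : R) (z : R[i]) :
  complex.Re ((r%:C)%C * z) = r * complex.Re z.
Proof. by case: z => a b /=; rewrite mul0r subr0. Qed.

Lemma Im_mul_real {R : realType} (r : R) (z : R[i]) :
  complex.Im ((r%:C)%C * z) = r * complex.Im z.
Proof. by case: z => a b /=; rewrite mul0r addr0. Qed.

(** The value at a grid point [x] of the function [(F_omega' f^)^vee] of the paper,
    for [eta = n], [omega' = P] and [f t] given on the grid by [h]. *)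
Definition discrete_solution {R : realType} (n P : nat) (h : int -> R[i]) (x : R) :
  R[i] :=
  n%:R^-1 * symsum (n * n) (fun k =>
    (if (- (P * n)%:Z <= k) && (k <= (P * n)%:Z) then 2^-1 else 0) *
    (n%:R^-1 * symsum (n * n) (fun j => h j *
      cis (- (pi * (j%:~R / n%:R) * (k%:~R / n%:R))))) *
    cis (pi * (k%:~R / n%:R) * x)).

Section HeatLimit.
Variables (R : realType) (g : R -> R[i]).
Hypotheses (g_cont : continuous (g : R -> R[i]^o))
  (g_growth : forall e : R, 0 < e ->
    exists C : R, forall x, normc (g x) <= C * expR (e * x ^+ 2)).

Let window (n w : nat) (j : int) : R[i] :=
  if (- (w * n)%:Z <= j) && (j < (w * n)%:Z) then g (j%:~R / n%:R) else 0.

Lemma discrete_solutionE (n w P i : nat) (a : int -> int -> R[i]) (x : R) :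
  (0 < n)%N -> (w * n + i.*2 <= n * n)%N -> (w * n + 2 <= n * n)%N ->
  (0 < i)%N -> (P < n)%N ->
  (forall j, - (n * n)%:Z <= j -> j <= (n * n)%:Z - 1 -> a 0 j = window n w j) ->
  (forall i j, 0 <= i -> i <= (n * n)%:Z - 2 ->
     - (n * n)%:Z <= j -> j <= (n * n)%:Z - 1 ->
     n%:R * (a (i + 1) j - a i j) -
     forward_diff R n (forward_diff R n (a i)) j = 0) ->
  discrete_solution n P (a i%:Z) x =
  symsum (w * n) (fun j =>
    n%:R^-1 * g (j%:~R / n%:R) * heat_kernel n P i (x - j%:~R / n%:R)).
Proof.
move=> n0 wni wn2 i0 Pn a0 aS.
have supp j : (j < - (w * n)%:Z) || ((w * n)%:Z <= j) -> window n w j = 0.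
  by move=> jw; rewrite /window ifF//; lia.
rewrite -inv_fourier_sum//; last first.
  by rewrite -(@leq_pmul2r n)//; apply: leq_trans wni; rewrite leq_addr.
congr (_ * _); apply: eq_symsum => k _ _; congr (_ * (_ * _) * _).
rewrite -(@stencil_fourier _ n (w * n) (window n w) supp i (n * n))//.
apply: eq_symsum => j j1 j2; congr (_ * cis (- _)).
  by apply: (@heat_stencil _ n (w * n) (window n w) supp) => //; lia.
by field; rewrite pnatr_eq0 -lt0n.
Qed.

(** On the window [z ^ 2 <= w ^ 2 < P], so growth at rate 1 costs at most [expR P]. There are
    [2 w n] terms of weight [1 / n], and [w <= P]. *)
Lemma kernel_sum_error (n w P i : nat) (C D x x1 : R) (kappa : R -> R) :
  (0 < n)%N -> (w * w < P)%N -> 0 <= D -> `|x| <= x1 ->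
  (forall z, normc (g z) <= C * expR (1 * z ^+ 2)) ->
  (forall u, `|u| <= x1 + P%:R ->
    normc (heat_kernel n P i u - ((kappa u)%:C)%C) <= D) ->
  normc (symsum (w * n) (fun j =>
      n%:R^-1 * g (j%:~R / n%:R) * heat_kernel n P i (x - j%:~R / n%:R)) -
    symsum (w * n) (fun j =>
      n%:R^-1 * g (j%:~R / n%:R) * ((kappa (x - j%:~R / n%:R))%:C)%C)) <=
  2 * P%:R * (C * expR P%:R) * D.
Proof.
move=> n0 wP D0 xx1 gC hD.
have nR : 0 < n%:R :> R by rewrite ltr0n.
have C0 : 0 <= C.
  by have := le_trans (normc_ge0 _) (gC 0); rewrite pmulr_lge0// expR_gt0.
have ninv : (n%:R^-1 : R[i]) = ((n%:R^-1 : R)%:C)%C by rewrite fmorphV rmorph_nat.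
rewrite /symsum -sumrB; apply: le_trans (normc_sum _ _ _ _) _.
apply: (@le_trans _ _ (\sum_(k < (w * n).*2) n%:R^-1 * (C * expR P%:R) * D)).
  apply: ler_sum => k _; rewrite -mulrBr !normcM ninv normc_real.
  rewrite ger0_norm ?invr_ge0 ?(ltW nR)//.
  set z : R := _%:~R / n%:R.
  have zw : `|z| <= w%:R.
    rewrite /z normrM normfV (gtr0_norm nR) ler_pdivrMr// -natrM -intr_norm.
    by rewrite (pmulrn _ (w * n)) ler_int; have := ltn_ord k; lia.
  have wP' : w%:R ^+ 2 <= P%:R :> R by rewrite -natrX ler_nat; lia.
  have wP2 : w%:R <= P%:R :> R by rewrite ler_nat; nia.
  apply: ler_pM; rewrite ?mulr_ge0 ?normc_ge0 ?invr_ge0//.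
    rewrite ler_pM2l ?invr_gt0//; apply: le_trans (gC z) _.
    rewrite mul1r ler_wpM2l// ler_expR; apply: le_trans wP'.
    by rewrite -(real_normK (num_real z)) lerXn2r ?nnegrE.
  apply: hD; apply: le_trans (ler_normB _ _) _; apply: lerD => //.
  exact: le_trans zw wP2.
rewrite sumr_const card_ord -[leLHS]mulr_natl.
have -> : (w * n).*2%:R * (n%:R^-1 * (C * expR P%:R) * D) =
    2 * w%:R * (C * expR P%:R) * D.
  by rewrite -muln2 !natrM; field; rewrite gt_eqF.
have wP2 : w%:R <= P%:R :> R by rewrite ler_nat; nia.
by rewrite ler_wpM2r// ler_wpM2r ?ler_pM2l// mulr_ge0 ?expR_ge0.
Qed.

Lemma kernel_sumE (n w : nat) (s b x : R) :
  symsum (w * n) (fun j => n%:R^-1 * g (j%:~R / n%:R) *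
    ((2^-1 * (expR (- (b * (x - j%:~R / n%:R) ^+ 2)) * s))%:C)%C) =
  ((2^-1 * s * riemann_sum R n w
     (fun z => complex.Re (g z) * expR (- (b * (x - z) ^+ 2)))) +i*
   (2^-1 * s * riemann_sum R n w
     (fun z => complex.Im (g z) * expR (- (b * (x - z) ^+ 2)))))%C.
Proof.
have ninv : (n%:R^-1 : R[i]) = ((n%:R^-1 : R)%:C)%C by rewrite fmorphV rmorph_nat.
apply/eqP; rewrite eq_complex; apply/andP; split; apply/eqP.
  rewrite /symsum raddf_sum /= /riemann_sum mulr_sumr; apply: eq_bigr => k _.
  by rewrite ninv -mulrA Re_mul_real mulrC [X in complex.Re X]mulrC Re_mul_real; ring.
rewrite /symsum raddf_sum /= /riemann_sum mulr_sumr; apply: eq_bigr => k _.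
by rewrite ninv -mulrA Im_mul_real mulrC [X in complex.Im X]mulrC Im_mul_real; ring.
Qed.

Lemma discrete_solution_lim (t0 x0 e : R) : 0 < t0 -> 0 < e ->
  exists (M : nat) (d : R), 0 < d /\
  forall (n w P : nat) (a : int -> int -> R[i]) (t x : R),
    (M <= n)%N -> (M <= w)%N -> (M <= P)%N -> (w + M <= n)%N -> (w * w < P)%N ->
    expR (P%:R ^+ 2) <= n%:R :> R -> `|t - t0| < d -> `|x - x0| < d ->
    (forall j, - (n * n)%:Z <= j -> j <= (n * n)%:Z - 1 ->
      a 0 j = window n w j) ->
    (forall i j, 0 <= i -> i <= (n * n)%:Z - 2 ->
      - (n * n)%:Z <= j -> j <= (n * n)%:Z - 1 ->
      n%:R * (a (i + 1) j - a i j) -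
      forward_diff R n (forward_diff R n (a i)) j = 0) ->
    normc (discrete_solution n P (a (Num.floor (n%:R * t)))
      ((Num.floor (n%:R * x))%:~R / n%:R) - heat_solution g t0 x0) < e.
Proof.
move=> t00 e0.
have e3 : 0 < e / 3 by rewrite divr_gt0.
have Re_growth : forall e : R, 0 < e -> exists C : R, forall x : R,
    `|complex.Re (g x)| <= C * expR (e * x ^+ 2).
  move=> d /g_growth[C gC]; exists C => x.
  exact: le_trans (abs_Re_le_normc _) (gC x).
have Im_growth : forall e : R, 0 < e -> exists C : R, forall x : R,
    `|complex.Im (g x)| <= C * expR (e * x ^+ 2).
  move=> d /g_growth[C gC]; exists C => x.
  exact: le_trans (abs_Im_le_normc _) (gC x).
have [M1 [d1 [d10 L1]]] := main_term_lim _ t0 x0 (e / 3)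
  (continuous_Re _ g g_cont) Re_growth t00 e3.
have [M2 [d2 [d20 L2]]] := main_term_lim _ t0 x0 (e / 3)
  (continuous_Im _ g g_cont) Im_growth t00 e3.
have [C gC] := g_growth 1 ltr01.
have C0 : 0 <= C.
  by have := le_trans (normc_ge0 _) (gC 0); rewrite pmulr_lge0// expR_gt0.
have t10 : 0 < t0 / 2 by rewrite divr_gt0.
have t1T : t0 / 2 <= 2 * t0 by lra.
have x10 : 0 <= `|x0| + 1 by rewrite addr_ge0.
have [K K0 HK] := heat_kernel_error (t0 / 2) (2 * t0) (`|x0| + 1) t10 t1T x10.
(* The slower of the two rates in [heat_kernel_error]. The 4 in [4 * C * K] is the width [2 P] of
   the window times two exponentials. *)
pose c := Num.min 1 (pi ^+ 2 * (t0 / 2)).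
have c0 : 0 < c by rewrite lt_min ltr01 mulr_gt0// exprn_gt0// pi_gt0.
have CK : 0 <= 4 * C * K by rewrite mulr_ge0// mulr_ge0.
have [M3 L3] := poly_exp_gauss_lim c (4 * C * K) (e / 3) c0 CK e3.
pose dd := Num.min (Num.min d1 d2) (Num.min (t0 / 2) 1).
have dd0 : 0 < dd by rewrite !lt_min d10 d20 t10 ltr01.
(* [2 / dd] makes the rounding to the grid smaller than [dd / 2], the other half being left to [t]
   and [x]; [4 * t0] bounds the distance [2 i / n] travelled by the support, to be compared with the
   gap [n - w >= M]. *)
pose M4 := (Num.trunc (2 / dd) + Num.trunc (4 * t0)).+2.
exists (maxn (maxn M1 M2) (maxn M3 M4)), (dd / 2); split; first by rewrite divr_gt0.
move=> n w P a t x; set M := maxn _ _ => Mn Mw MP wMn wP Pn td xd a0 aS.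
have [MM1 MM2 MM3 MM4] : [/\ (M1 <= M)%N, (M2 <= M)%N, (M3 <= M)%N & (M4 <= M)%N].
  by rewrite /M !leq_max !leqnn !orbT.
clearbody M.
have M_2 : (2 <= M)%N by exact: leq_trans MM4.
have n0 : (0 < n)%N by clear -M_2 Mn; lia.
have nR : 0 < n%:R :> R by rewrite ltr0n.
have P0 : (0 < P)%N by clear -M_2 MP; lia.
have nd : n%:R^-1 < dd / 2.
  rewrite -[dd / 2]invrK ltf_pV2 ?posrE ?invr_gt0 ?divr_gt0// invf_div.
  apply: natr_gt; apply: leq_trans (leq_trans MM4 Mn).
  by rewrite /M4; move: (Num.trunc _) (Num.trunc _) => p q; clear; lia.
have Mt : 4 * t0 < M%:R.
  apply: natr_gt; apply: leq_trans MM4.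
  by rewrite /M4; move: (Num.trunc _) (Num.trunc _) => p q; clear; lia.
have near_node (z z0 : R) : `|z - z0| < dd / 2 ->
    `|(Num.floor (n%:R * z))%:~R / n%:R - z0| < dd.
  have /andP[] := cell_node _ n z n0; move: (_ / _) => y.
  rewrite !ltr_norml => y1 y2 /andP[z1 z2].
  by clear -g_cont g_growth nd y1 y2 z1 z2; apply/andP; split; lra.
have := near_node _ _ xd; set xr := _ / _ => xrd.
have := near_node _ _ td.
have floor_ge : 0 <= Num.floor (n%:R * t).
  rewrite floor_ge0 mulr_ge0// ltW//.
  have : dd <= t0 / 2 by rewrite /dd !ge_min lexx orbT.
  move: td; rewrite ltr_norml => /andP[h1 _] h2.
  by clear -g_cont g_growth h1 h2 t00; lra.
have [i iE] : exists i : nat, Num.floor (n%:R * t) = i%:Z.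
  by exists (absz (Num.floor (n%:R * t))); rewrite gez0_abs.
rewrite iE => td'.
have [xd1 xd2 xd3] : [/\ `|xr - x0| < d1, `|xr - x0| < d2 & `|xr - x0| < 1].
  by move: xrd; rewrite /dd !lt_min => /andP[/andP[-> ->] /andP[_ ->]].
have [td1 td2 td3] : [/\ `|i%:R / n%:R - t0| < d1, `|i%:R / n%:R - t0| < d2 &
    `|i%:R / n%:R - t0| < t0 / 2].
  by move: td'; rewrite /dd !lt_min -pmulrn => /andP[/andP[-> ->] /andP[-> _]].
have /andP[ti iT] : t0 / 2 <= i%:R / n%:R <= 2 * t0.
  move: td3; rewrite ltr_norml => /andP[h1 h2].
  by clear -g_cont g_growth h1 h2 t00; apply/andP; split; lra.
have i0 : (0 < i)%N.
  rewrite lt0n; apply/negP => /eqP i00; move: ti; by rewrite i00 mul0r leNgt t10.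
have iM : (i.*2 <= M * n)%N.
  rewrite -(ler_nat R) -muln2 !natrM.
  have h1 : i%:R <= 2 * t0 * n%:R by rewrite -ler_pdivrMr.
  have h2 : 4 * t0 * n%:R <= M%:R * n%:R by rewrite ler_pM2r// ltW.
  by clear -g_cont g_growth h1 h2; lra.
have P_lt_n : (P < n)%N.
  rewrite -(ltr_nat R); apply: lt_le_trans Pn.
  apply: lt_le_trans (expR_ge1Dx _).
  have PP : (P <= P ^ 2)%N by rewrite -mulnn leq_pmull.
  by apply: (@le_lt_trans _ _ (P%:R ^+ 2)); rewrite ?ltrDr// -natrX ler_nat.
have wMn2 : ((w + M) * n <= n * n)%N by rewrite leq_mul2r wMn orbT.
rewrite (discrete_solutionE n w P i a xr n0 _ _ i0 P_lt_n a0 aS); last 2 first.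
- by clear -wMn2 iM; nia.
- by clear -wMn2 M_2 n0; nia.
set tau : R := i%:R / n%:R in td1 td2 ti iT *.
pose S := gauss_sum (pi ^+ 2 * tau) n%:R^-1 0 (P * n).
pose kappa (u : R) := 2^-1 * (expR (- ((4 * tau)^-1 * u ^+ 2)) * S).
set U := symsum _ _; set H := heat_solution _ _ _.
pose V := symsum (w * n) (fun j => n%:R^-1 * g (j%:~R / n%:R) *
    ((kappa (xr - j%:~R / n%:R))%:C)%C).
pose D := K * P%:R ^+ 5 *
  (expR (- (P%:R ^+ 2)) + expR (- (pi ^+ 2 * (t0 / 2) * P%:R ^+ 2))).
have D0 : 0 <= D by rewrite mulr_ge0 ?addr_ge0 ?expR_ge0// mulr_ge0 ?exprn_ge0.
have UV : normc (U - V) < e / 3.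
  apply: le_lt_trans (L3 P _); last by exact: leq_trans MP.
  apply: le_trans (kernel_sum_error n w P i C D xr (`|x0| + 1) kappa n0 wP D0 _ gC _) _.
  - rewrite -[xr](subrK x0) addrC; apply: le_trans (ler_normD _ _) _.
    by rewrite lerD2l ltW.
  - by move=> u uP; apply: HK => //; rewrite ti iT.
  have -> : 4 * C * K * P%:R ^+ 6 * expR P%:R * expR (- (c * P%:R ^+ 2)) =
    2 * P%:R * (C * expR P%:R) * (K * P%:R ^+ 5 *
      (expR (- (c * P%:R ^+ 2)) + expR (- (c * P%:R ^+ 2)))) by ring.
  have PP : 0 <= P%:R ^+ 2 :> R by rewrite exprn_ge0.
  rewrite ler_wpM2l//.
    by rewrite mulr_ge0// mulr_ge0 ?expR_ge0.
  rewrite ler_wpM2l ?mulr_ge0 ?exprn_ge0//.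
  apply: lerD; rewrite ler_expR lerN2; [rewrite -[leRHS]mul1r|];
    by rewrite ler_wpM2r// /c ge_min lexx ?orbT.
have VH : normc (V - H) < e / 3 + e / 3.
  have VE := kernel_sumE n w S (4 * tau)^-1 xr.
  rewrite -/V in VE.
  apply: le_lt_trans (normc_le_abs _) _.
  have HE : H = ((Num.sqrt (4 * pi * t0))^-1%:C)%C * cintegral
      (fun y => ((expR (- (x0 - y) ^+ 2 / (4 * t0)))%:C)%C * g y).
    by rewrite /H /heat_solution t00.
  pose E (y : R) := ((expR (- (x0 - y) ^+ 2 / (4 * t0)))%:C)%C * g y.
  have EE : cintegral E =
    (\int[lebesgue_measure]_z (expR (- (x0 - z) ^+ 2 / (4 * t0)) * complex.Re (g z))
    +i* \int[lebesgue_measure]_z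
      (expR (- (x0 - z) ^+ 2 / (4 * t0)) * complex.Im (g z)))%C.
    congr (_ +i* _)%C; apply: eq_Rintegral => z _.
      exact: Re_mul_real.
    exact: Im_mul_real.
  rewrite HE -/E EE.
  apply: ltrD; rewrite raddfB VE /= mul0r ?subr0 ?addr0.
    by apply: L1 => //; [exact: leq_trans Mn|exact: leq_trans Mw|exact: leq_trans MP].
  by apply: L2 => //; [exact: leq_trans Mn|exact: leq_trans Mw|exact: leq_trans MP].
rewrite -[U](subrK V) -addrA; apply: le_lt_trans (le_normcD _ _) _.
by clear -g_cont g_growth UV VH; lra.
Qed.
End HeatLimit.

(** * Transfer *)

Section TransferToolkit.
Variable U : nsuniverse.
Local Notation star := (star U).

Lemma smap_smap (A B C : Type) (h : B -> C) (k : A -> B) (q : star A) :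
  smap h (smap k q) = smap (fun y => h (k y)) q.
Proof. by rewrite -smap_comp. Qed.

Lemma spair_smap (T A B : Type) (a : T -> A) (b : T -> B) (q : star T) :
  spair (smap a q) (smap b q) = smap (fun y => (a y, b y)) q.
Proof. by rewrite smap_pairE. Qed.

Lemma smap2_smap (T A B C : Type) (h : A -> B -> C) (a : T -> A) (b : T -> B)
    (q : star T) :
  smap2 h (smap a q) (smap b q) = smap (fun y => h (a y) (b y)) q.
Proof. by rewrite /smap2 spair_smap smap_smap. Qed.

Lemma sapp_smap (T A B : Type) (F : T -> A -> B) (a : T -> A) (q : star T) :
  sapp (smap F q) (smap a q) = smap (fun y => F y (a y)) q.
Proof. by rewrite /sapp smap2_smap. Qed.

Lemma sholds_smapE (A B : Type) (h : A -> B) (P : B -> Prop) (q : star A) :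
  sholds P (smap h q) = sholds (fun y => P (h y)) q.
Proof. by apply/propext; exact: sholds_smap. Qed.

Lemma sholds2_smap (T A B : Type) (P : A -> B -> Prop) (a : T -> A) (b : T -> B)
    (q : star T) :
  sholds2 P (smap a q) (smap b q) = sholds (fun y => P (a y) (b y)) q.
Proof. by rewrite /sholds2 spair_smap sholds_smapE. Qed.

Lemma sholds_andE (T : Type) (P Q : T -> Prop) (q : star T) :
  (sholds P q /\ sholds Q q) = sholds (fun y => P y /\ Q y) q.
Proof. by apply/propext; split => /sholds_and. Qed.

Lemma sholds_imp (T : Type) (P Q : T -> Prop) (q : star T) :
  sholds (fun y => P y -> Q y) q <-> (sholds P q -> sholds Q q).
Proof.
have -> : (fun y => P y -> Q y) = fun y => ~ (P y /\ ~ Q y).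
  apply/funext => y; apply/propext; split => [PQ [/PQ Qy]|nPQ Py]; first exact.
  by apply: contrapT => nQy; exact: nPQ.
rewrite sholds_not sholds_and sholds_not; split=> [nPQ Pq|PQ [Pq nQ]].
  by apply: contrapT => nQ; apply: nPQ; split.
by apply: nQ; exact: PQ.
Qed.

Lemma sholds_impl (T : Type) (P Q : T -> Prop) (q : star T) :
  (forall y, P y -> Q y) -> sholds P q -> sholds Q q.
Proof. by move=> PQ; apply/sholds_imp; exact: sholds_all. Qed.

(** [star bool] has only two elements, so the external case distinction agrees with the internal
    one. *)
Lemma if_smap (T A : Type) (P : T -> Prop) (a b : T -> A) (q : star T) :
  (if `[< sholds P q >] then smap a q else smap b q) =
  smap (fun y => if `[< P y >] then a y else b y) q.
Proof.
case: asboolP => Pq; symmetry; apply/sholds_eq.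
  by apply: sholds_impl Pq => y Py; rewrite asboolT.
by move/sholds_not: Pq; apply: sholds_impl => y Py; rewrite asboolF.
Qed.

(** All the parameters of a formula are kept in one internal tuple [p]; an internal
    variable [j] is introduced by passing from [p] to [spair p j]. *)
Lemma smap_lift (T A B : Type) (h : T -> A) (p : star T) (j : star B) :
  smap h p = smap (fun y => h y.1) (spair p j).
Proof. by rewrite -{1}(smap_fst p j) smap_smap. Qed.

Lemma smap_ind (A B : Type) (p : star A) (j : star B) :
  j = smap snd (spair p j).
Proof. by rewrite smap_snd. Qed.

Lemma sholds_forall_pair (T B : Type) (P : T -> B -> Prop) (p : star T) :
  (forall j, sholds (fun y => P y.1 y.2) (spair p j)) ->
  sholds (fun y => forall b, P y b) p.
Proof. by move=> h; apply/sholds_forall => j; exact: h. Qed.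

(** [hsum] uses some internal [F] that agrees with [a] on the range. With [F] added to the tuple,
    [eq_symsum] transfers and shows that every choice gives the sum of [G]. *)
Lemma hsum_smap (R : realType) (T : Type) (N : T -> nat) (G : T -> int -> R[i])
    (p : star T) (a : star int -> star R[i]) :
  (forall j, (- hnatZ (smap N p) <= j)%H -> (j <= hnatZ (smap N p) - 1)%H ->
    a j = smap (fun y => G y.1 y.2) (spair p j)) ->
  hsum (smap N p) a = smap (fun y => symsum (N y) (G y)) p.
Proof.
move=> aG.
have sappE (F : star (int -> R[i])) j :
    sapp F j = smap (fun y => y.1.2 y.2) (spair (spair p F) j).
  rewrite {1}[F](smap_ind _ _ p) (smap_lift _ _ _ _ _ j).
  by rewrite {2}[j](smap_ind _ _ (spair p F) j) sapp_smap.
have sappG j : sapp (smap G p) j = smap (fun y => G y.1 y.2) (spair p j).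
  by rewrite (smap_lift _ _ _ G p j) {2}[j](smap_ind _ _ p j) sapp_smap.
rewrite /hsum; case: pselect => [exF|[]]; last first.
  by exists (smap G p) => j j1 j2; rewrite sappG aG.
case: (cid exF) => F /= FE.
rewrite (smap_lift _ _ _ N p F) {2}[F](smap_ind _ _ p) smap2_smap.
rewrite (smap_lift _ _ _ (fun y => symsum (N y) (G y)) p F).
apply/sholds_eq.
suff: sholds (fun y : T * (int -> R[i]) => forall j, - (N y.1)%:Z <= j ->
    j <= (N y.1)%:Z - 1 -> y.2 j = G y.1 j) (spair p F).
  by apply: sholds_impl => y yG; apply: eq_symsum.
apply: sholds_forall_pair => j; apply/sholds_imp => j1; apply/sholds_imp => j2.
have r1 : (- hnatZ (smap N p) <= j)%H.
  rewrite /hle /hopp /hnatZ (smap_lift _ _ _ N p F) !smap_smap.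
  rewrite (smap_lift _ _ _ _ (spair p F) j).
  by rewrite {2}[j](smap_ind _ _ (spair p F) j) sholds2_smap.
have r2 : (j <= hnatZ (smap N p) - 1)%H.
  rewrite /hle /hsub /hone /hnatZ (smap_lift _ _ _ N p F) !smap_smap.
  rewrite (smap_lift _ _ _ _ (spair p F) j) -(smap_const _ (spair (spair p F) j)).
  by rewrite smap2_smap {1}[j](smap_ind _ _ (spair p F) j) sholds2_smap.
apply/sholds_eq; rewrite -sappE FE// aG//.
rewrite (_ : spair p j = smap (fun y => (y.1.1, y.2)) (spair (spair p F) j)).
  by rewrite smap_smap.
by rewrite smap_pairE smap_snd -(smap_lift _ _ _ fst) smap_fst.
Qed.
End TransferToolkit.

(** * Standard parts and infinite integers *)

Section StandardParts.
Variables (U : nsuniverse) (R : realType).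

Lemma sholds_const (A : Type) (P : Prop) (x : star U A) :
  sholds (fun=> P) x -> P.
Proof.
rewrite /sholds smap_const => h; apply: contrapT => nP.
by apply: (@star_bool_neq U); rewrite -h asboolF.
Qed.

Lemma sholds_and2 (A : Type) (P Q S : A -> Prop) (x : star U A) :
  (forall a, P a -> Q a -> S a) -> sholds P x -> sholds Q x -> sholds S x.
Proof.
move=> PQS Px Qx; apply: (@sholds_impl _ _ (fun a => P a /\ Q a)).
  by move=> a [/PQS]; apply.
by apply/sholds_and.
Qed.

Lemma infinitesimalB (x : star U R) (r : R) :
  infinitesimal (x - sconst r)%H <->
  forall e : R, 0 < e -> sholds (fun a => `|a - r| < e) x.
Proof.
rewrite /infinitesimal /hlt /hsub -{1}(smap_id x) -(smap_const r x).
rewrite smap2_smap smap_smap.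
by split=> h e e0; have := h e e0; rewrite -(smap_const e x) sholds2_smap.
Qed.

Lemma st_eq (x : star U R) (r : R) :
  (forall e : R, 0 < e -> sholds (fun a => `|a - r| < e) x) -> st x = r.
Proof.
move=> xr; apply: xget_unique; first exact/infinitesimalB.
move=> s /infinitesimalB xs; apply/eqP; rewrite -subr_eq0 -normr_eq0 eq_le.
rewrite normr_ge0 andbT; apply/ler_addgt0Pr => e e0; rewrite add0r.
have e2 : 0 < e / 2 by rewrite divr_gt0.
apply: (@sholds_const _ _ x); apply: (sholds_and2 _ _ _ _ _ _ (xr _ e2) (xs _ e2)).
move=> a ar sa; have -> : s - r = (a - r) - (a - s) by ring.
by apply: le_trans (ler_normB _ _) _; rewrite [e]splitr ltW// ltrD.
Qed.

(** The standard part is the supremum of the standard reals below [x], a nonempty bounded set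
    because [x] is finite. *)
Lemma st_close (x : star U R) : finiteR x ->
  forall e : R, 0 < e -> sholds (fun a => `|a - st x| < e) x.
Proof.
move=> [r]; rewrite /hle -{1}(smap_id x) -(smap_const r x) smap_smap sholds2_smap.
move=> xr; apply/infinitesimalB.
suff [s xs] : exists s : R, infinitesimal (x - sconst s)%H.
  exact: (@xgetPex _ 0 [set s : R | infinitesimal (x - sconst s)%H]
    (ex_intro _ s xs)).
pose S : set R := [set s | sholds (fun a => s <= a) x]%classic.
have supS : has_sup S.
  split; first exists (- r).
    by apply: sholds_impl xr => a; rewrite ler_norml => /andP[].
  exists r => s sx; apply: (@sholds_const _ _ x).
  apply: (sholds_and2 _ _ _ _ _ _ sx xr) => a sa.
  by rewrite ler_norml => /andP[_]; exact: le_trans.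
exists (sup S); apply/infinitesimalB => e e0.
have e2 : 0 < e / 2 by rewrite divr_gt0.
have [s sS es] := sup_adherent e2 supS.
have nS : sholds (fun a => ~ (sup S + e / 2 <= a)) x.
  apply/sholds_not => Se; have := ub_le_sup supS.2 Se.
  by rewrite gerDl leNgt e2.
apply: (sholds_and2 _ _ _ _ _ _ nS sS) => a /negP; rewrite -ltNge => h1 h2.
by rewrite ltr_norml; apply/andP; split; lra.
Qed.

Lemma stC_eq (z : star U R[i]) (h : R[i]) :
  (forall e : R, 0 < e -> sholds (fun c => normc (c - h) < e) z) ->
  finiteC z /\ stC z = h.
Proof.
move=> zh; split.
  exists (normc h + 1).
  rewrite /hle -{1}(smap_id z) -(smap_const _ z) smap_smap sholds2_smap.
  apply: sholds_impl (zh 1 ltr01) => c ch; rewrite -[`|c|]/((normc c)%:C)%C lecR.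
  rewrite -[c](subrK h); apply: le_trans (le_normcD _ _) _.
  by rewrite addrC lerD2l ltW.
case: h zh => a b zh; rewrite /stC; congr (_ +i* _)%C; apply: st_eq => e e0.
  apply/sholds_smap; apply: sholds_impl (zh e e0) => c; apply: le_lt_trans.
  by apply: le_trans (abs_Re_le_normc _); rewrite raddfB.
apply/sholds_smap; apply: sholds_impl (zh e e0) => c; apply: le_lt_trans.
by apply: le_trans (abs_Im_le_normc _); rewrite raddfB.
Qed.

Lemma infinite_hnat_ge (n : star U nat) : infinite_hnat n ->
  forall M : nat, sholds (fun k => (M <= k)%N) n.
Proof.
move=> n_inf; elim=> [|M ih]; first exact: sholds_all.
have nM : sholds (fun k => k <> M) n.
  apply/sholds_not => nM; apply: (n_inf M).
  rewrite -(smap_const M n) -{1}(smap_id n); exact/sholds_eq.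
by apply: (sholds_and2 _ _ _ _ _ _ ih nM) => k; rewrite leq_eqVlt eq_sym => /orP[/eqP|].
Qed.
End StandardParts.

Lemma cexp_cis {R : realType} (s a b : R) :
  cexp (Complex 0 (s * pi) * (a%:C)%C * (b%:C)%C) = cis (s * pi * a * b).
Proof.
have -> : Complex 0 (s * pi) * (a%:C)%C * (b%:C)%C = Complex 0 (s * pi * a * b).
  by apply/eqP; rewrite eq_complex /=; apply/andP; split; apply/eqP; ring.
by rewrite /cexp [complex.Re _]/= expR0 mul1r.
Qed.

Lemma floor_node {R : realType} (n : nat) (k : int) : (0 < n)%N ->
  Num.floor (n%:R * (k%:~R / n%:R) : R) = k.
Proof. by move=> n0; rewrite mulrC divfK ?intrKfloor// pnatr_eq0 -lt0n. Qed.

(** Collapses an expression built from constants and images of [q] into a single [smap] or [sholds]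
    over [q]; constants first become images of [q] under constant functions. *)
Ltac to_smap q := rewrite /space_index /time_index /in_space /in_time /in_cell
  /last_time_cell /gridpt /hle /hlt /hadd /hsub /hopp /hmul /hdiv /hnatZ /hnatR
  /hintR /hrealC /hfloor /hone /hzero -?(smap_const _ q)
  ?(sapp_smap, smap2_smap, sholds2_smap, sholds_andE, spair_smap, smap_smap).

(** * Operators at grid points as internal functions of the parameters *)

Section Grid.
Variables (U : nsuniverse) (R : realType) (T : Type) (q : star U T) (e : T -> nat).
Hypothesis e0 : sholds (fun y => (0 < e y)%N) q.
Local Notation eta := (smap e q).

Definition space_range (n : nat) (k : int) :=
  - (n * n)%:Z <= k /\ k <= (n * n)%:Z - 1.

Lemma gridpt_smap (k : T -> int) :
  gridpt R eta (smap k q) = smap (fun y => (k y)%:~R / (e y)%:R) q.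
Proof. by to_smap q. Qed.

Lemma hfloor_smap (r : T -> R) :
  hfloor (hnatR R eta * smap r q)%H = smap (fun y => Num.floor ((e y)%:R * r y)) q.
Proof. by to_smap q. Qed.

Lemma hfloor_gridpt (k : T -> int) :
  hfloor (hnatR R eta * gridpt R eta (smap k q))%H = smap k q.
Proof.
rewrite gridpt_smap hfloor_smap; apply/sholds_eq.
by apply: sholds_impl e0 => y; exact: floor_node.
Qed.

Lemma in_space_gridpt (k : T -> int) :
  sholds (fun y => space_range (e y) (k y)) q ->
  in_space eta (gridpt R eta (smap k q)).
Proof.
rewrite gridpt_smap => ke; to_smap q.
apply: sholds_and2 ke e0 => y [k1 k2] n0; have nR : 0 < (e y)%:R :> R by rewrite ltr0n.
split; first rewrite ler_pdivlMr// mulNr -natrM (pmulrn _ (e y * e y)) -intrN ler_int//.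
rewrite ltr_pdivrMr// -natrM (pmulrn _ (e y * e y)) ltr_int.
by rewrite -ltzD1 subrK in k2.
Qed.

(** The hypothesis ranges over all internal indices and the conclusion has the same shape, so the
    lemma applies to its own output and reaches the second derivative. *)
Lemma ddx_gridpt (h : star U R -> star U R -> star U R[i]) (t : star U R)
    (G : T -> int -> R[i]) :
  (forall k, sholds (fun y => space_range (e y) (k y)) q ->
    h t (gridpt R eta (smap k q)) = smap (fun y => G y (k y)) q) ->
  forall k, sholds (fun y => space_range (e y) (k y)) q ->
    ddx eta h t (gridpt R eta (smap k q)) =
    smap (fun y => forward_diff R (e y) (G y) (k y)) q.
Proof.
move=> hG k kr; rewrite /ddx hfloor_gridpt.
have -> : (smap k q + 1)%H = smap (fun y => k y + 1) q by to_smap q.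
have -> : (smap k q <= hnatZ eta * hnatZ eta - sconst 2%:Z)%H =
    sholds (fun y => k y <= (e y * e y)%:Z - 2) q by to_smap q.
case: asboolP => [k2|nk2].
  rewrite !hG//; last first.
    by apply: sholds_and2 kr k2 => y [k1 _] k2; split; lia.
  to_smap q; apply/sholds_eq; apply: sholds_impl k2 => y k2.
  by rewrite /forward_diff k2 rmorph_nat.
rewrite /hzero -(smap_const _ q); apply/sholds_eq.
by move/sholds_not: nk2; apply: sholds_impl => y /negP/negPf k2; rewrite /forward_diff k2.
Qed.

Lemma ddt_gridpt (h : star U R -> star U R -> star U R[i]) (i : T -> int)
    (x : star U R) (a b : T -> R[i]) :
  sholds (fun y => i y <= (e y * e y)%:Z - 2) q ->
  h (gridpt R eta (smap i q)) x = smap a q ->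
  h (gridpt R eta (smap (fun y => i y + 1) q)) x = smap b q ->
  ddt eta h (gridpt R eta (smap i q)) x = smap (fun y => (e y)%:R * (b y - a y)) q.
Proof.
move=> i2 ha hb; rewrite /ddt hfloor_gridpt.
have -> : (smap i q + 1)%H = smap (fun y => i y + 1) q by to_smap q.
have -> : (smap i q <= hnatZ eta * hnatZ eta - sconst 2%:Z)%H =
    sholds (fun y => i y <= (e y * e y)%:Z - 2) q by to_smap q.
rewrite asboolT// ha hb; to_smap q; apply/sholds_eq; apply: sholds_all => y.
by rewrite rmorph_nat.
Qed.

Lemma exp_eta_gridpt (s : R) (k : T -> int) (r : T -> R) :
  exp_eta eta s (gridpt R eta (smap k q)) (smap r q) =
  smap (fun y => cis (s * pi * ((k y)%:~R / (e y)%:R) *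
    ((Num.floor ((e y)%:R * r y))%:~R / (e y)%:R))) q.
Proof.
rewrite /exp_eta hfloor_gridpt hfloor_smap; to_smap q.
by apply/sholds_eq; apply: sholds_all => y; rewrite cexp_cis.
Qed.

Lemma cutoff_gridpt (P : T -> nat) (t : star U R) (k : T -> int) :
  hrealC (cutoff eta (smap P q) t (gridpt R eta (smap k q))) =
  smap (fun y => if (- (P y * e y)%:Z <= k y) && (k y <= (P y * e y)%:Z)
    then 2^-1 else 0) q.
Proof.
rewrite /cutoff hfloor_gridpt; to_smap q.
rewrite if_smap smap_smap; apply/sholds_eq; apply: sholds_all => y.
rewrite -PoszM asbool_and !asboolb.
by case: ifP => _; rewrite ?rmorph0// fmorphV rmorph_nat.
Qed.

Lemma truncated_ext_gridpt (g : R -> R[i]) (w : T -> nat) (k : T -> int) :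
  truncated_ext eta g (smap w q) (gridpt R eta (smap k q)) =
  smap (fun y => if (- (w y * e y)%:Z <= k y) && (k y < (w y * e y)%:Z)
    then g ((k y)%:~R / (e y)%:R) else 0) q.
Proof.
rewrite /truncated_ext /measurable_ext hfloor_gridpt /indic_window; to_smap q.
rewrite if_smap ?(smap_smap, smap2_smap); apply/sholds_eq.
apply: sholds_impl e0 => y n0; have nR : 0 < (e y)%:R :> R by rewrite ltr0n.
rewrite ler_pdivlMr// ltr_pdivrMr// mulNr -natrM (pmulrn _ (w y * e y)) -intrN.
rewrite ler_int ltr_int asbool_and !asboolb.
by case: ifP => _; rewrite ?rmorph1 ?mulr1// rmorph0 mulr0.
Qed.
End Grid.

Lemma smap_lift_mid (U : nsuniverse) (T A B C : Type) (h : T * B -> C) (p : star U T)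
    (k : star U A) (j : star U B) :
  smap h (spair p j) = smap (fun y => h (y.1.1, y.2)) (spair (spair p k) j).
Proof.
rewrite (_ : spair p j = smap (fun y => (y.1.1, y.2)) (spair (spair p k) j)).
  by rewrite smap_smap.
by rewrite smap_pairE smap_snd -(smap_lift _ _ _ _ fst) smap_fst.
Qed.

Lemma hintegral_smap (U : nsuniverse) (R : realType) (T : Type) (q : star U T)
    (e : T -> nat) (u : star U R -> star U R[i]) (G : T -> int -> R[i]) :
  (forall j, sholds (fun y => space_range (e y.1) y.2) (spair q j) ->
    u (gridpt R (smap e q) j) = smap (fun y => G y.1 y.2) (spair q j)) ->
  hintegral (smap e q) u =
  smap (fun y => (e y)%:R^-1 * symsum (e y * e y) (G y)) q.
Proof.
move=> uG; rewrite /hintegral.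
have -> : (smap e q * smap e q)%H = smap (fun y => e y * e y)%N q by to_smap q.
rewrite (hsum_smap _ _ _ _ G); last first.
  move=> j j1 j2; apply: uG; move: j1 j2.
  rewrite (smap_lift _ _ _ _ (fun y => e y * e y)%N q j).
  rewrite [X in (_ <= X)%H -> _](smap_ind _ _ _ q j).
  rewrite [X in _ -> (X <= _)%H -> _](smap_ind _ _ _ q j).
  by to_smap (spair q j) => j1 j2; rewrite -sholds_andE.
to_smap q; apply/sholds_eq; apply: sholds_all => y.
by rewrite rmorph_nat div1r.
Qed.

(** Only the values of [f] at the given time and at grid points matter. The tuple is extended twice,
    by the frequency index [k] and then by the space index [j]; at nodes the rounding in [exp_eta]
    is undone by [floor_node]. *)
Lemma inv_fourier_smap (U : nsuniverse) (R : realType) (T : Type) (p : star U T)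
    (e P : T -> nat) (t x : T -> R) (h : T -> int -> R[i])
    (f : star U R -> star U R -> star U R[i]) :
  sholds (fun y => (0 < e y)%N) p ->
  (forall j, sholds (fun y => space_range (e y.1) y.2) (spair p j) ->
    f (smap t p) (gridpt R (smap e p) j) = smap (fun y => h y.1 y.2) (spair p j)) ->
  inv_fourier (smap e p)
    (fun s y => (hrealC (cutoff (smap e p) (smap P p) s y) *
                 fourier (smap e p) f s y)%H) (smap t p) (smap x p) =
  smap (fun y => discrete_solution (e y) (P y) (h y)
    ((Num.floor ((e y)%:R * x y))%:~R / (e y)%:R)) p.
Proof.
move=> e0 fh; rewrite /inv_fourier.
rewrite (@hintegral_smap _ _ _ p e _ (fun y k =>
  (if (- (P y * e y)%:Z <= k) && (k <= (P y * e y)%:Z) then 2^-1 else 0) *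
  ((e y)%:R^-1 * symsum (e y * e y) (fun j => h y j *
    cis (-1 * pi * (j%:~R / (e y)%:R) *
      ((Num.floor ((e y)%:R * (k%:~R / (e y)%:R) : R))%:~R / (e y)%:R)))) *
  cis (1 * pi * (k%:~R / (e y)%:R) *
    ((Num.floor ((e y)%:R * x y))%:~R / (e y)%:R)))); last first.
  move=> k _; set q := spair p k.
  have lift (A : Type) (v : T -> A) : smap v p = smap (fun y => v y.1) q.
    exact: smap_lift.
  have kE : k = smap snd q by exact: smap_ind.
  have eq0 : sholds (fun y => (0 < e y.1)%N) q.
    by move: e0; rewrite -{1}(smap_fst p k) sholds_smapE.
  rewrite /fourier !lift (@hintegral_smap _ _ _ q (fun y => e y.1) _
    (fun y j => h y.1 j * cis (-1 * pi * (j%:~R / (e y.1)%:R) *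
      ((Num.floor ((e y.1)%:R * (y.2%:~R / (e y.1)%:R) : R))%:~R / (e y.1)%:R))));
    last first.
    move=> j jr.
    have -> : f (smap (fun y => t y.1) q) (gridpt R (smap (fun y => e y.1) q) j) =
        smap (fun y => h y.1.1 y.2) (spair q j).
      rewrite -!lift fh ?(smap_lift_mid _ _ _ _ _ _ p k j)//.
      move: jr; rewrite /sholds => <-; symmetry.
      by rewrite (smap_lift_mid _ _ _ _ _ _ p k j).
    have eqj0 : sholds (fun y => (0 < e y.1.1)%N) (spair q j).
      by move: eq0; rewrite -{1}(smap_fst q j) sholds_smapE.
    rewrite kE gridpt_smap (smap_lift _ _ _ _ (fun y => e y.1) q j).
    rewrite (smap_lift _ _ _ _ (fun y : T * int => y.2%:~R / (e y.1)%:R) q j).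
    rewrite [X in gridpt _ _ X](smap_ind _ _ _ q j) exp_eta_gridpt//.
    by to_smap (spair q j).
  rewrite kE cutoff_gridpt// exp_eta_gridpt//.
  by to_smap q.
apply/sholds_eq; apply: sholds_impl e0 => y n0; rewrite /discrete_solution.
congr (_ * _); apply: eq_symsum => k _ _; rewrite mul1r.
congr (_ * (_ * _) * _).
apply: eq_symsum => j _ _; rewrite floor_node// mulN1r.
by rewrite !mulNr.
Qed.

(** * Transfer of the hypotheses on the solution *)

Section Transfer.
Variables (U : nsuniverse) (R : realType) (T : Type) (p : star U T).
Variables (e w P : T -> nat) (F : T -> R -> R -> R[i]) (t x : T -> R).
Variables (g : R -> R[i]) (f : star U R -> star U R -> star U R[i]).
Hypotheses (e0 : sholds (fun y => (0 < e y)%N) p)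
  (f_internal : forall s z, in_time (smap e p) s -> in_space (smap e p) z ->
    f s z = sapp (sapp (smap F p) s) z)
  (f_cell : forall i j, time_index (smap e p) i -> space_index (smap e p) j ->
    forall s s' z z', in_cell (smap e p) i s -> in_cell (smap e p) i s' ->
      in_cell (smap e p) j z -> in_cell (smap e p) j z' -> f s z = f s' z')
  (f_heat : heat_equation (smap e p) f)
  (f_init : forall z : star U R, in_space (smap e p) z ->
    f 0%H z = truncated_ext (smap e p) g (smap w p) z)
  (t_time : in_time (smap e p) (smap t p)).

Let node (n : nat) (k : int) : R := k%:~R / n%:R.

(** [q] is [p] extended by indices and [pr] projects back, so one statement serves any number of
    quantified indices. *)
Lemma f_gridpt (T' : Type) (q : star U T') (pr : T' -> T) (qp : smap pr q = p)
    (r : T' -> R) (k : T' -> int) :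
  in_time (smap (fun y => e (pr y)) q) (smap r q) ->
  sholds (fun y => space_range (e (pr y)) (k y)) q ->
  f (smap r q) (gridpt R (smap (fun y => e (pr y)) q) (smap k q)) =
  smap (fun y => F (pr y) (r y) (node (e (pr y)) (k y))) q.
Proof.
have eq0 : sholds (fun y => (0 < e (pr y))%N) q.
  by move: e0; rewrite -qp sholds_smapE.
have eE : smap e p = smap (fun y => e (pr y)) q by rewrite -qp smap_smap.
move=> r_time kr; rewrite f_internal ?eE//; last exact: in_space_gridpt.
by rewrite gridpt_smap -qp smap_smap !sapp_smap.
Qed.

Lemma in_time_gridpt (T' : Type) (q : star U T') (e' : T' -> nat) (k : T' -> int) :
  sholds (fun y => (0 < e' y)%N) q ->
  sholds (fun y => 0 <= k y /\ k y <= (e' y * e' y)%:Z - 1) q ->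
  in_time (smap e' q) (smap (fun y => node (e' y) (k y)) q).
Proof.
move=> eq0 kr; to_smap q; apply: sholds_and2 kr eq0 => y [k1 k2] n0.
have nR : 0 < (e' y)%:R :> R by rewrite ltr0n.
split; first by rewrite divr_ge0// ler0z.
rewrite ltr_pdivrMr// -natrM (pmulrn _ (e' y * e' y)) ltr_int.
by rewrite -ltzD1 subrK in k2.
Qed.

Lemma transfer_init : sholds (fun y => forall j : int, space_range (e y) j ->
  F y 0 (node (e y) j) =
  if (- (w y * e y)%:Z <= j) && (j < (w y * e y)%:Z) then g (node (e y) j) else 0) p.
Proof.
apply: sholds_forall_pair => j; apply/sholds_imp => jr; apply/sholds_eq.
set q := spair p j in jr *.
have qp : smap fst q = p by rewrite smap_fst.
have eq0 : sholds (fun y => (0 < e y.1)%N) q by move: e0; rewrite -{1}qp sholds_smapE.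
have eE : smap e p = smap (fun y => e y.1) q by exact: smap_lift.
have wE : smap w p = smap (fun y => w y.1) q by exact: smap_lift.
rewrite -truncated_ext_gridpt// -eE -wE -f_init; last first.
  by rewrite eE; exact: in_space_gridpt.
rewrite /hzero -(smap_const _ q) eE (f_gridpt _ _ _ qp)//.
have -> : smap (fun=> 0 : R) q = smap (fun y => node (e y.1) 0) q.
  by apply/sholds_eq; apply: sholds_all => y; rewrite /node mul0r.
apply: in_time_gridpt => //; apply: sholds_impl eq0 => y n0.
split=> //; nia.
Qed.

Lemma transfer_heat : sholds (fun y => forall i j : int, 0 <= i ->
  i <= (e y * e y)%:Z - 2 -> space_range (e y) j ->
  (e y)%:R * (F y (node (e y) (i + 1)) (node (e y) j) -
              F y (node (e y) i) (node (e y) j)) -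
  forward_diff R (e y) (forward_diff R (e y)
    (fun l => F y (node (e y) i) (node (e y) l))) j = 0) p.
Proof.
apply: sholds_forall_pair => i; apply: sholds_forall_pair => j.
apply/sholds_imp => i1; apply/sholds_imp => i2; apply/sholds_imp => jr.
set q := spair (spair p i) j in i1 i2 jr *.
have qp : smap (fun y => y.1.1) q = p by rewrite -(smap_lift _ _ _ _ fst) smap_fst.
have eq0 : sholds (fun y => (0 < e y.1.1)%N) q.
  by move: e0; rewrite -{1}qp sholds_smapE.
have eE : smap e p = smap (fun y => e y.1.1) q by rewrite -{1}qp smap_smap.
have i3 : sholds (fun y : T * int * int => 0 <= y.1.2 /\ y.1.2 <= (e y.1.1 * e y.1.1)%:Z - 1) q.
  by apply: sholds_and2 i1 i2 => y h1 h2; split; lia.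
have i4 : sholds (fun y : T * int * int => 0 <= y.1.2 + 1 /\
    y.1.2 + 1 <= (e y.1.1 * e y.1.1)%:Z - 1) q.
  by apply: sholds_and2 i1 i2 => y h1 h2; split; lia.
have := f_heat (gridpt R (smap e p) (smap (fun y => y.1.2) q))
  (gridpt R (smap e p) (smap snd q)).
rewrite eE => /(_ _ _ _).
have ti := in_time_gridpt _ q (fun y => e y.1.1) _ eq0 i3.
have ti' := in_time_gridpt _ q (fun y => e y.1.1) _ eq0 i4.
rewrite (@ddt_gridpt _ _ _ q _ eq0 f _ _
  (fun y => F y.1.1 (node (e y.1.1) y.1.2) (node (e y.1.1) y.2))
  (fun y => F y.1.1 (node (e y.1.1) (y.1.2 + 1)) (node (e y.1.1) y.2)))//;
  last 2 first.
- by rewrite [X in f X _]gridpt_smap (f_gridpt _ _ _ qp).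
- by rewrite [X in f X _]gridpt_smap (f_gridpt _ _ _ qp).
rewrite (@ddx_gridpt _ _ _ q _ eq0 _ _ (fun y =>
  forward_diff R (e y.1.1) (fun l => F y.1.1 (node (e y.1.1) y.1.2)
    (node (e y.1.1) l))))//; last first.
  move=> k kr; apply: ddx_gridpt => // l lr.
  by rewrite [X in f X _]gridpt_smap (f_gridpt _ _ _ qp).
move=> H; apply/sholds_eq; rewrite (smap_const 0 q) -[RHS]H.
- by to_smap q.
- by rewrite gridpt_smap.
(* A point of the last time cell would have index at least [n ^ 2 - 1], against [i2]. *)
- rewrite gridpt_smap => -[]; to_smap q => h _.
  have {}h : sholds (fun y : T * int * int => (0 < e y.1.1)%N ->
      y.1.2 <= (e y.1.1 * e y.1.1)%:Z - 2 -> False) q.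
    apply: sholds_impl h => y + n0.
    by rewrite ler_pM2r ?invr_gt0 ?ltr0n// ler_int /= PoszM; lia.
  apply: (@sholds_const _ _ False q).
  by move/sholds_imp: h => /(_ eq0)/sholds_imp/(_ i2).
- exact: in_space_gridpt.
Qed.

(** Constancy on cells moves [t] to the left end of its cell, where the recurrence determines
    [f]. *)
Lemma transfer_cell : sholds (fun y => forall j : int, space_range (e y) j ->
  F y (t y) (node (e y) j) =
  F y (node (e y) (Num.floor ((e y)%:R * t y))) (node (e y) j)) p.
Proof.
apply: sholds_forall_pair => j; apply/sholds_imp => jr; apply/sholds_eq.
set q := spair p j in jr *.
have qp : smap fst q = p by rewrite smap_fst.
have eq0 : sholds (fun y => (0 < e y.1)%N) q by move: e0; rewrite -{1}qp sholds_smapE.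
have eE : smap e p = smap (fun y => e y.1) q by exact: smap_lift.
have tE : smap t p = smap (fun y => t y.1) q by exact: smap_lift.
pose i (y : T * int) := Num.floor ((e y.1)%:R * t y.1).
have tq : sholds (fun y => 0 <= t y.1 /\ t y.1 < (e y.1)%:R) q.
  by move: t_time; rewrite tE eE; to_smap q.
have ir : sholds (fun y => 0 <= i y /\ i y <= (e y.1 * e y.1)%:Z - 1) q.
  apply: sholds_and2 tq eq0 => y [t1 t2] n0.
  have nR : 0 < (e y.1)%:R :> R by rewrite ltr0n.
  split; first by rewrite floor_ge0 mulr_ge0// ltW.
  rewrite -ltzD1 subrK floor_lt_int -(pmulrn _ (e y.1 * e y.1)) natrM.
  by rewrite ltr_pM2l.
have := f_cell (smap i q) (smap snd q) _ _ (smap t p)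
  (smap (fun y => node (e y.1) (i y)) q)
  (gridpt R (smap e p) (smap snd q)) (gridpt R (smap e p) (smap snd q)).
rewrite tE eE (f_gridpt _ _ _ qp)//; last by rewrite -tE -eE.
rewrite (f_gridpt _ _ _ qp)//; last exact: in_time_gridpt.
have node_cell (k : T * int -> int) :
    in_cell (smap (fun y => e y.1) q) (smap k q)
      (smap (fun y => node (e y.1) (k y)) q).
  to_smap q; apply: sholds_impl eq0 => y n0; split; first exact: lexx.
  by rewrite ltr_pM2r ?invr_gt0 ?ltr0n// ltr_int ltzD1.
rewrite gridpt_smap; apply.
- by to_smap q.
- by to_smap q.
- to_smap q; apply: sholds_impl eq0 => y n0.
  have nR : 0 < (e y.1)%:R :> R by rewrite ltr0n.
  rewrite ler_pdivrMr// ltr_pdivlMr// ![t _ * _]mulrC.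
  by have /andP[] := floor_itv ((e y.1)%:R * t y.1).
- exact: node_cell.
- exact: node_cell.
- exact: node_cell.
Qed.
End Transfer.

Lemma heat_transfer {U : nsuniverse} {R : realType} (T : Type) (p : star U T)
    (e w P : T -> nat) (F : T -> R -> R -> R[i]) (t x : T -> R) (g : R -> R[i])
    (f : star U R -> star U R -> star U R[i]) (A B rho : R) :
  continuous (g : R -> R[i]^o) -> rho < 2 ->
  (forall x : R, `|g x| <= (A * expR (B * `|x| `^ rho))%:C%C) ->
  infinite_hnat (smap e p) -> infinite_hnat (smap w p) ->
  infinite_hnat (smap P p) ->
  pos_infinite (hnatR R (smap e p) - hnatR R (smap w p))%H ->
  (hnatR R (smap w p) < smap Num.sqrt (hnatR R (smap P p)))%H ->
  (hnatR R (smap P p) < smap Num.sqrt (smap (@ln R) (hnatR R (smap e p))))%H ->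
  (forall s z, in_time (smap e p) s -> in_space (smap e p) z ->
    f s z = sapp (sapp (smap F p) s) z) ->
  (forall i j, time_index (smap e p) i -> space_index (smap e p) j ->
    forall s s' z z', in_cell (smap e p) i s -> in_cell (smap e p) i s' ->
      in_cell (smap e p) j z -> in_cell (smap e p) j z' -> f s z = f s' z') ->
  heat_equation (smap e p) f ->
  (forall z : star U R, in_space (smap e p) z ->
    f 0%H z = truncated_ext (smap e p) g (smap w p) z) ->
  in_time (smap e p) (smap t p) -> finiteR (smap t p) -> 0 < st (smap t p) ->
  finiteR (smap x p) ->
  let u := inv_fourier (smap e p) (fun s y =>
    (hrealC (cutoff (smap e p) (smap P p) s y) * fourier (smap e p) f s y)%H) in
  finiteC (u (smap t p) (smap x p)) /\
  stC (u (smap t p) (smap x p)) = heat_solution g (st (smap t p)) (st (smap x p)).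
Proof.
move=> g_cont rho2 g_growth e_inf w_inf P_inf ew wP Pe f_int f_cell f_heat f_init.
move=> t_time t_fin t_pos x_fin u.
have large M : [/\ sholds (fun y => (M <= e y)%N) p,
    sholds (fun y => (M <= w y)%N) p & sholds (fun y => (M <= P y)%N) p].
  by split; rewrite -(sholds_smapE _ _ _ _ (fun k => (M <= k)%N));
    exact: infinite_hnat_ge.
have [e0 _ _] := large 1%N.
rewrite /u (@inv_fourier_smap _ _ _ p e P t x
  (fun y j => F y (t y) (j%:~R / (e y)%:R)))//; last first.
  move=> j jr.
  have qp : smap fst (spair p j) = p by rewrite smap_fst.
  rewrite (smap_lift _ _ _ _ e p j) (smap_lift _ _ _ _ t p j).
  rewrite [X in gridpt _ _ X](smap_ind _ _ _ p j).
  rewrite (f_gridpt _ _ _ _ _ _ f e0 f_int _ _ _ qp)//.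
  by rewrite -!smap_lift.
apply: stC_eq => eps eps0; rewrite sholds_smapE.
have growth := subquadratic_growth _ _ g_cont _ _ _ rho2 g_growth.
have [M [d [d0 lim]]] := discrete_solution_lim _ g g_cont growth _ (st (smap x p))
  eps t_pos eps0.
(* Infiniteness and closeness to standard parts are needed only up to the standard thresholds [M]
   and [d]. *)
have [eM wM PM] := large M.
have tc := st_close _ _ _ t_fin d d0; rewrite sholds_smapE in tc.
have xc := st_close _ _ _ x_fin d d0; rewrite sholds_smapE in xc.
have ewM := ew M%:R.
move: ewM wP Pe; to_smap p => ewM wP Pe.
have hinit := transfer_init _ _ _ _ _ w F _ _ e0 f_int f_init.
have hheat := transfer_heat _ _ _ _ _ F _ e0 f_int f_heat.
have hcell := transfer_cell _ _ _ _ _ F t _ e0 f_int f_cell t_time.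
(* Every hypothesis now holds of the single tuple [p]; what remains is an implication between
   standard statements about its values [y]. *)
have all_hyps := conj e0 (conj eM (conj wM (conj PM (conj tc (conj xc (conj ewM
  (conj wP (conj Pe (conj hinit (conj hheat hcell)))))))))).
rewrite !sholds_andE in all_hyps.
apply: sholds_impl all_hyps => y.
move=> [n0 [eMy [wMy [PMy [tcy [xcy [ewy [wPy [Pey [init [heat cell]]]]]]]]]]].
have wPn : (w y * w y < P y)%N.
  rewrite -(ltr_nat R) natrM -expr2.
  have -> : (P y)%:R = Num.sqrt (P y)%:R ^+ 2 :> R by rewrite sqr_sqrtr.
  by rewrite ltrXn2r// nnegrE sqrtr_ge0.
have Pexp : expR ((P y)%:R ^+ 2) <= (e y)%:R :> R.
  rewrite -[leRHS]lnK ?posrE ?ltr0n// ler_expR ltW//.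
  have ln0 : 0 <= ln (e y)%:R :> R by rewrite ln_ge0// ler1n.
  rewrite -(sqr_sqrtr ln0) ltrXn2r ?nnegrE ?sqrtr_ge0//.
have wMe : (w y + M <= e y)%N.
  rewrite -(ler_nat R) natrD; move: ewy => /=; lra.
have -> : discrete_solution (e y) (P y) (fun j => F y (t y) (j%:~R / (e y)%:R))
    ((Num.floor ((e y)%:R * x y))%:~R / (e y)%:R) =
  discrete_solution (e y) (P y)
    ((fun i j : int => F y (i%:~R / (e y)%:R) (j%:~R / (e y)%:R))
      (Num.floor ((e y)%:R * t y))) ((Num.floor ((e y)%:R * x y))%:~R / (e y)%:R).
  rewrite /discrete_solution; congr (_ * _); apply: eq_symsum => k _ _.
  congr (_ * (_ * _) * _); apply: eq_symsum => j j1 j2; congr (_ * _).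
  by apply: cell.
apply: (lim (e y) (w y) (P y)
  (fun i j : int => F y (i%:~R / (e y)%:R) (j%:~R / (e y)%:R)) (t y) (x y)) => //.
- by move=> j j1 j2; rewrite mul0r; apply: init.
- by move=> i j i1 i2 j1 j2; apply: heat.
Qed.

Theorem theorem0p18 (U : nsuniverse) (Usat : countably_saturated U)
    (R : realType) (g : R -> R[i]) (A B rho : R)
    (g_cont : continuous (g : R -> R[i]^o))
    (rho_lt2 : rho < 2)
    (g_growth : forall x : R, `|g x| <= (A * expR (B * `|x| `^ rho))%:C%C)
    (eta omega omega' : star U nat)
    (eta_inf : infinite_hnat eta)
    (omega_inf : infinite_hnat omega)
    (omega'_inf : infinite_hnat omega')
    (eta_omega : pos_infinite (hnatR R eta - hnatR R omega)%H)
    (omega_omega' : (hnatR R omega < smap Num.sqrt (hnatR R omega'))%H)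
    (omega'_eta : (hnatR R omega' < smap Num.sqrt (smap (@ln R) (hnatR R eta)))%H)
    (f : star U R -> star U R -> star U R[i])
    (f_meas : measurable2 eta f)
    (f_heat : heat_equation eta f)
    (f_init : forall x : star U R,
      in_space eta x -> f 0%H x = truncated_ext eta g omega x) :
  forall t x : star U R,
    in_time eta t -> finiteR t -> 0 < st t -> in_space eta x -> finiteR x ->
    let u := inv_fourier eta
      (fun s y => (hrealC (cutoff eta omega' s y) * fourier eta f s y)%H) in
    finiteC (u t x) /\ stC (u t x) = heat_solution g (st t) (st x).
Proof.
move=> t x t_time t_fin t_pos _ x_fin.
case: f_meas => -[F f_int] f_cell.
(* The internal function [F] representing [f] joins the parameters, so that the hypotheses on [f]
   transfer together with those on the numbers. *)
pose p := spair (spair (spair (spair (spair eta omega) omega') F) t) x.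
have xE : smap snd p = x by rewrite smap_snd.
have tE : smap (fun y => y.1.2) p = t.
  by rewrite -(smap_lift _ _ _ _ snd) smap_snd.
have FE : smap (fun y => y.1.1.2) p = F.
  rewrite -(smap_lift _ _ _ _ (fun y => y.1.2)) -(smap_lift _ _ _ _ snd).
  by rewrite smap_snd.
have PE : smap (fun y => y.1.1.1.2) p = omega'.
  rewrite -(smap_lift _ _ _ _ (fun y => y.1.1.2)).
  rewrite -(smap_lift _ _ _ _ (fun y => y.1.2)) -(smap_lift _ _ _ _ snd).
  by rewrite smap_snd.
have wE : smap (fun y => y.1.1.1.1.2) p = omega.
  rewrite -(smap_lift _ _ _ _ (fun y => y.1.1.1.2)).
  rewrite -(smap_lift _ _ _ _ (fun y => y.1.1.2)).
  rewrite -(smap_lift _ _ _ _ (fun y => y.1.2)) -(smap_lift _ _ _ _ snd).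
  by rewrite smap_snd.
have eE : smap (fun y => y.1.1.1.1.1) p = eta.
  rewrite -(smap_lift _ _ _ _ (fun y => y.1.1.1.1)).
  rewrite -(smap_lift _ _ _ _ (fun y => y.1.1.1)).
  rewrite -(smap_lift _ _ _ _ (fun y => y.1.1)) -(smap_lift _ _ _ _ fst).
  by rewrite smap_fst.
have := @heat_transfer U R _ p (fun y => y.1.1.1.1.1) (fun y => y.1.1.1.1.2)
  (fun y => y.1.1.1.2) (fun y => y.1.1.2) (fun y => y.1.2) snd g f A B rho.
rewrite eE wE PE FE tE xE; exact.
Qed.
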